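(* Let $(\lambda_n)_{n\ge 0}$ be real numbers with $0=\lambda_0<\lambda_1<\lambda_2<\cdots$, let $A_0=1$ and let $A_n$, $n\ge 1$, be positive real numbers. Define $\Lambda(x)=\sum_{\lambda_n\le x}A_n$ (assumed finite for every $x$). Let $\varepsilon:[1,\infty)\to(0,\infty)$ be a decreasing function with $$\int_1^\infty\frac{\varepsilon(x)}{x}\,dx<\infty,$$ and suppose that $$Y\,\Lambda(X)\ll\Lambda(X+Y)-\Lambda(X)\qquad(\varepsilon(X)\ll Y\ll 1),$$ i.e. there are constants $c_1,c_2,c_3>0$ and $X_0\ge 1$ such that $\Lambda(X+Y)-\Lambda(X)\ge c_3\,Y\,\Lambda(X)$ for all $X\ge X_0$ and all $Y$ with $c_1\varepsilon(X)\le Y\le c_2$. Let $H>0$. Then: (i) The set of Dirichlet polynomials $$\left\{\sum_{n=1}^N a_n e^{-\lambda_n it}:\ N\ge 1,\ a_n\in\mathbb{C},\ |a_n|\le A_n\right\}$$ is dense in $L^2(0,H)$ if and only if $$\int_1^\infty\frac{\log\Lambda(x)}{x^2}\,dx=\infty .$$ (ii) If in addition $\sum_{n=1}^\infty A_n^2<\infty$, then the equivalence in (i) remains true when the condition $|a_n|\le A_n$ is replaced by $|a_n|=A_n$. (iii) If in addition $\sum_{n=1}^\infty A_n^2<\infty$, then the equivalence in (i) also remains true when the set of Dirichlet polynomials is replaced by the set of all Dirichlet series $\sum_{n=1}^\infty a_n e^{-\lambda_n it}$ with $a_n\in\mathbb{C}$, $|a_n|=A_n$ for all $n\ge 1$,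 that are convergent in $L^2(0,H)$.
   Context: $L^2(0,H)$ is the Hilbert space of complex-valued square-integrable functions on $(0,H)$, and Dirichlet polynomials and series are regarded as functions of $t\in(0,H)$. The sum defining $\Lambda(x)$ runs over all $n\ge 0$ with $\lambda_n\le x$. *)

(* Defs.v *)
(* MathComp world: MathComp-Analysis, with complex numbers R[i] over a realType. *)
From HB Require Import structures.
From mathcomp Require Import all_boot all_order all_algebra.
From mathcomp Require Import all_classical all_reals all_analysis.
From mathcomp Require Import complex.

Set Implicit Arguments.
Unset Strict Implicit.
Unset Printing Implicit Defensive.

Import Order.TTheory GRing.Theory Num.Theory.
Import numFieldNormedType.Exports.

Local Open Scope classical_set_scope.
Local Open Scope ring_scope.
Local Open Scope complex_scope.

(* |z| as an element of R; MathComp's `|z| is its image in R[i]. *)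
Definition cabs (R : realType) (z : R[i]) : R := ComplexField.Normc.normc z.

Definition expi (R : realType) (x : R) : R[i] := cos x +i* sin x.

Definition L2norm (R : realType) (H : R) (f : R -> R[i]) : \bar R :=
  'N[@lebesgue_measure R]_2%:E[(fun t => (cabs (f t))%:E) \_ `]0, H[].

(* Square-integrable functions on ]0, H[, as representatives: values outside
   the interval are irrelevant, and two functions are the same element of the
   Hilbert space when L2norm of their difference is 0. *)
Definition L2 (R : realType) (H : R) : set (R -> R[i]) :=
  [set f | [/\ measurable_fun `]0, H[ (fun t => complex.Re (f t)),
               measurable_fun `]0, H[ (fun t => complex.Im (f t)) &
               (L2norm H f < +oo)%E]].

Definition L2dense (R : realType) (H : R) (S : set (R -> R[i])) : Prop :=
  forall f, L2 H f -> forall e : R, 0 < e ->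
    exists g, [/\ S g, L2 H g & (L2norm H (f \- g)%R < e%:E)%E].

Definition L2cvg (R : realType) (H : R) (u : nat -> R -> R[i])
    (f : R -> R[i]) : Prop :=
  (fun N => L2norm H (u N \- f)) @ \oo --> 0%E.

Section Dirichlet.
Context {R : realType}.
Implicit Types (lam A : nat -> R) (a : nat -> R[i]) (H x : R).

(* The index set may a priori be infinite, hence a sum in \bar R. *)
Definition eLambda lam A x : \bar R :=
  \esum_(n in [set n | lam n <= x]) (A n)%:E.

Definition Lambda lam A x : R := fine (eLambda lam A x).

Definition dirichlet_poly lam a (N : nat) : R -> R[i] :=
  fun t => \sum_(1 <= n < N.+1) a n * expi (- (lam n * t)).

Definition polys_le lam A : set (R -> R[i]) :=
  [set f | exists N a, [/\ (1 <= N)%N,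
     (forall n, (1 <= n <= N)%N -> cabs (a n) <= A n) &
     f = dirichlet_poly lam a N]].

Definition polys_eq lam A : set (R -> R[i]) :=
  [set f | exists N a, [/\ (1 <= N)%N,
     (forall n, (1 <= n <= N)%N -> cabs (a n) = A n) &
     f = dirichlet_poly lam a N]].

Definition series_eq H lam A : set (R -> R[i]) :=
  [set f | L2 H f /\ exists a,
     (forall n, (1 <= n)%N -> cabs (a n) = A n) /\
     L2cvg H (dirichlet_poly lam a) f].

End Dirichlet.

(* Main.v *)
(* Taking Y = c2 in the growth hypothesis shows that Lambda grows exponentially,
   so the logarithmic integral is always infinite and each equivalence amounts
   to the density of the corresponding set.

   For large x, the function exp(-ixt) is recovered by Lagrange interpolation
   from N ~ eta x nodes lambda_n, one in each of N short windows to the right of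
   x; averaging over all choices of nodes, drawn with probabilities proportional
   to A_n, gives coefficients b_n with |b_n| <= K exp(-tau x) A_n, because the
   mass of every window is exponentially large, and an error K exp(-tau x).

   Put z = exp(-i delta t) and rho = exp(-tau delta). For small delta, z runs
   over an arc that a vertical line separates from the disc of radius rho, so by
   pole pushing there are polynomials z^J Q(z) close to 1 on the arc whose norm
   sum_k |q_k| rho^k is small. Replacing each power z^k in z^m z^J Q(z) by its
   approximation above, every z^m, hence every polynomial in t, is a uniform
   limit of Dirichlet polynomials with |a_n| <= e A_n supported far out.

   To get |a_n| = A_n, write b_n as the midpoint of b_n + d_n and b_n - d_n of
   modulus A_n and choose the signs greedily by the parallelogram law; the error
   is then controlled by a tail of sum_n A_n^2. *)
Require Import Defs.
From HB Require Import structures.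
From mathcomp Require Import all_boot all_order all_algebra.
From mathcomp Require Import all_classical all_reals all_analysis.
From mathcomp Require Import measurable_realfun complex ring lra zify.

Set Implicit Arguments.
Unset Strict Implicit.
Unset Printing Implicit Defensive.

Import Order.TTheory GRing.Theory Num.Theory.
Import numFieldNormedType.Exports.

Local Open Scope classical_set_scope.
Local Open Scope ring_scope.

(** * Modulus and exponentials *)

(** Only the total mass of a window is bounded below; a single [A n] may be arbitrarily small, so no
    fixed choice of nodes yields coefficients dominated by [A]. Each Lagrange weight depends on all
    nodes together, which is why the average runs over whole tuples and not window by window. Taking
    [N] proportional to [x] balances two exponentials: weights and window count cost at most
    [8 ^+ N], which has to stay well below the window mass [expR (k * x)], while the interpolation
    error is at most [2 * 2^-1 ^+ N].

    Since the error decays with the frequency, the k-th power of z costs [rho ^+ k], and a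
    combination of powers costs its weighted l1 norm. Low frequencies are too expensive to reach
    directly; what is needed is a polynomial without low powers that is close to 1 on the arc and
    small in a norm living on the disc of radius [rho]. This is Runge's theorem in the algebra
    normed by both the weighted l1 norm and the sup norm on the arc. The separating line exists
    because 1 - [rho] is linear in delta, whereas the arc recedes from the line Re z = 1 only
    quadratically. *)

Section ComplexModulus.
Context {R : realType}.
Implicit Types (x y : R) (z w : R[i]).
Local Open Scope complex_scope.

Lemma cabs_ge0 z : 0 <= cabs z.
Proof. by case: z => a b; exact: sqrtr_ge0. Qed.

Lemma cabs0 : cabs (0 : R[i]) = 0.
Proof. exact: ComplexField.Normc.normc0. Qed.

Lemma cabs1 : cabs (1 : R[i]) = 1.
Proof. exact: ComplexField.Normc.normc1. Qed.

Lemma cabs0_eq0 z : cabs z = 0 -> z = 0.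
Proof. exact: ComplexField.Normc.eq0_normc. Qed.

Lemma cabsM z w : cabs (z * w) = cabs z * cabs w.
Proof. exact: ComplexField.Normc.normcM. Qed.

Lemma cabsD z w : cabs (z + w) <= cabs z + cabs w.
Proof. exact: le_normcD. Qed.

Lemma cabsN z : cabs (- z) = cabs z.
Proof. exact: normcN. Qed.

Lemma cabsB z w : cabs (z - w) = cabs (w - z).
Proof. by rewrite -cabsN opprB. Qed.

Lemma cabsD3 w z (v : R[i]) : cabs (z - v) <= cabs (z - w) + cabs (w - v).
Proof. by rewrite -[z - v](subrKA w); exact: cabsD. Qed.

Lemma cabsX z n : cabs (z ^+ n) = cabs z ^+ n.
Proof. by elim: n => [|n IH]; rewrite ?expr0 ?cabs1// !exprS cabsM IH. Qed.

Lemma cabsV z : cabs z^-1 = (cabs z)^-1.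
Proof. exact: ComplexField.Normc.normcV. Qed.

Lemma cabsR x : cabs x%:C = `|x|.
Proof. by rewrite /cabs /= expr0n/= addr0 sqrtr_sqr. Qed.

Lemma cabs_sum (I : Type) (r : seq I) (P : pred I) (F : I -> R[i]) :
  cabs (\sum_(i <- r | P i) F i) <= \sum_(i <- r | P i) cabs (F i).
Proof.
elim/big_ind2 : _ => [|z x w y zx wy|//]; first by rewrite cabs0.
exact: le_trans (cabsD _ _) (lerD zx wy).
Qed.

Lemma cabs_sqr z : cabs z ^+ 2 = complex.Re z ^+ 2 + complex.Im z ^+ 2.
Proof. by case: z => a b /=; rewrite sqr_sqrtr// addr_ge0 ?sqr_ge0. Qed.

Lemma Re_le_cabs z : `|complex.Re z| <= cabs z.
Proof.
rewrite -[leRHS]ger0_norm ?cabs_ge0// -ler_sqr ?nnegrE//.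
by rewrite !real_normK ?num_real// cabs_sqr lerDl sqr_ge0.
Qed.

Lemma Im_le_cabs z : `|complex.Im z| <= cabs z.
Proof.
rewrite -[leRHS]ger0_norm ?cabs_ge0// -ler_sqr ?nnegrE//.
by rewrite !real_normK ?num_real// cabs_sqr lerDr sqr_ge0.
Qed.

Lemma cabs_le_ReIm z : cabs z <= `|complex.Re z| + `|complex.Im z|.
Proof.
rewrite [in leLHS](complexE z); apply: le_trans (cabsD _ _) _.
rewrite cabsM !cabsR (_ : cabs 'i%C = 1) ?mul1r//.
by rewrite /cabs/= expr0n/= add0r expr1n sqrtr1.
Qed.

Lemma cabs_parallelogram z w :
  cabs (z + w) ^+ 2 + cabs (z - w) ^+ 2 = 2 * cabs z ^+ 2 + 2 * cabs w ^+ 2.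
Proof. by rewrite !cabs_sqr; case: z w => a b [c d] /=; ring. Qed.

Lemma expi0 : expi (0 : R) = 1.
Proof. by rewrite /expi cos0 sin0. Qed.

Lemma expiD x y : expi (x + y) = expi x * expi y.
Proof.
rewrite /expi cosD sinD; congr (_ +i* _).
by rewrite addrC.
Qed.

Lemma expiX x n : expi x ^+ n = expi (x * n%:R).
Proof.
elim: n => [|n IH]; first by rewrite expr0 mulr0 expi0.
by rewrite exprS IH -expiD -{1}[x]mulr1 -mulrDr -natr1 addrC.
Qed.

Lemma cabs_expi x : cabs (expi x) = 1.
Proof. by rewrite /cabs /expi /= cos2Dsin2 sqrtr1. Qed.

Lemma Re_sum (I : Type) (r : seq I) (P : pred I) (F : I -> R[i]) :
  complex.Re (\sum_(i <- r | P i) F i) = \sum_(i <- r | P i) complex.Re (F i).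
Proof. by apply: (big_morph (@complex.Re R)) => // -[a b] [c d]. Qed.

Lemma Im_sum (I : Type) (r : seq I) (P : pred I) (F : I -> R[i]) :
  complex.Im (\sum_(i <- r | P i) F i) = \sum_(i <- r | P i) complex.Im (F i).
Proof. by apply: (big_morph (@complex.Im R)) => // -[a b] [c d]. Qed.

End ComplexModulus.

Arguments cabs : simpl never.
Arguments expi : simpl never.

(** * Runge approximation by polynomials in the weighted l1 norm *)

Section PolynomialRunge.
Context {R : realType}.
Variables (rho : R) (T : set R[i]).
Hypotheses (rho_ge0 : 0 <= rho) (rho_lt1 : rho < 1).
Hypothesis T_le1 : forall z, T z -> cabs z <= 1.
Implicit Types (P Q p q : {poly R[i]}) (e : R).

(** Norm of the algebra of power series that converge absolutely on the closed disc of radius [rho].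
    The factor [rho ^+ i] is the price of replacing the i-th power by its Dirichlet
    approximation. *)
Definition l1norm P : R := \sum_(i < size P) cabs P`_i * rho ^+ i.

Lemma l1normE n P : (size P <= n)%N ->
  l1norm P = \sum_(i < n) cabs P`_i * rho ^+ i.
Proof.
move=> Pn; rewrite /l1norm (big_ord_widen n (fun i => cabs P`_i * rho ^+ i))//.
rewrite big_mkcond/=; apply: eq_bigr => i _; case: ifPn => //.
by rewrite -leqNgt => /(nth_default 0) ->; rewrite cabs0 mul0r.
Qed.

Lemma l1norm_ge0 P : 0 <= l1norm P.
Proof. by apply: sumr_ge0 => i _; rewrite mulr_ge0 ?cabs_ge0 ?exprn_ge0. Qed.

Lemma l1normD P Q : l1norm (P + Q) <= l1norm P + l1norm Q.
Proof.
pose n := maxn (size P) (size Q).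
rewrite !(@l1normE n) ?leq_maxl ?leq_maxr//; last exact: size_polyD.
rewrite -big_split/=; apply: ler_sum => i _.
by rewrite -mulrDl ler_wpM2r ?exprn_ge0// coefD cabsD.
Qed.

Lemma l1normZ c P : l1norm (c *: P) = cabs c * l1norm P.
Proof.
rewrite (@l1normE (size P) (c *: P)) ?size_scale_leq// mulr_sumr.
by apply: eq_bigr => i _; rewrite coefZ cabsM mulrA.
Qed.

Lemma l1normMX P : l1norm (P * 'X) = rho * l1norm P.
Proof.
have [->|P0] := eqVneq P 0; first by rewrite mul0r /l1norm size_poly0 !big_ord0 mulr0.
rewrite /l1norm size_mulX// big_ord_recl coefMX/= cabs0 mul0r add0r mulr_sumr.
by apply: eq_bigr => i _; rewrite coefMX/= exprS mulrCA.
Qed.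

Lemma l1normMXn n P : l1norm (P * 'X^n) = rho ^+ n * l1norm P.
Proof.
elim: n => [|n IH]; first by rewrite expr0 mulr1 mul1r.
by rewrite exprSr mulrA l1normMX IH exprS mulrA.
Qed.

Lemma l1normM P Q : l1norm (P * Q) <= l1norm P * l1norm Q.
Proof.
rewrite -{1}[P]coefK poly_def mulr_suml.
have H (F : nat -> {poly R[i]}) n :
    l1norm (\sum_(i < n) F i) <= \sum_(i < n) l1norm (F i).
  elim: n => [|n IH]; first by rewrite !big_ord0 /l1norm size_poly0 big_ord0.
  by rewrite !big_ord_recr/= (le_trans (l1normD _ _))// lerD2r.
apply: le_trans (H (fun i => P`_i *: 'X^i * Q) _) _.
rewrite [X in _ <= X * _]/l1norm mulr_suml; apply: ler_sum => i _.
by rewrite -scalerAl l1normZ mulrC [_ * Q]mulrC l1normMXn mulrC mulrA.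
Qed.

(** Bounds the larger of two submultiplicative seminorms. As a relation it requires no supremum over
    [T]. *)
Definition small e P := l1norm P <= e /\ forall z, T z -> cabs P.[z] <= e.

Lemma small_le e e' P : e <= e' -> small e P -> small e' P.
Proof. by move=> ee' [? h]; split=> [|z /h]; exact: (fun x => le_trans x ee'). Qed.

Lemma smallD e e' P Q : small e P -> small e' Q -> small (e + e') (P + Q).
Proof.
move=> [P1 P2] [Q1 Q2]; split; first exact: le_trans (l1normD _ _) (lerD P1 Q1).
by move=> z Tz; rewrite hornerD (le_trans (cabsD _ _))// lerD ?P2 ?Q2.
Qed.

Lemma smallM e e' P Q : small e P -> small e' Q -> small (e * e') (P * Q).
Proof.
move=> [P1 P2] [Q1 Q2]; split.
  by apply: le_trans (l1normM _ _) _; rewrite ler_pM ?l1norm_ge0.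
by move=> z Tz; rewrite hornerM cabsM ler_pM ?cabs_ge0 ?P2 ?Q2.
Qed.

Lemma small1 : small 1 1.
Proof.
split=> [|z _]; last by rewrite hornerC cabs1.
by rewrite /l1norm size_poly1 big_ord1 coefC expr0 mulr1 cabs1.
Qed.

Lemma smallX e P n : small e P -> small (e ^+ n) (P ^+ n).
Proof.
move=> eP; elim: n => [|n IH]; first by rewrite !expr0; exact: small1.
by rewrite !exprS; exact: smallM.
Qed.

Lemma smallZ e c P : small e P -> small (cabs c * e) (c *: P).
Proof.
move=> [P1 P2]; split=> [|z Tz]; first by rewrite l1normZ ler_wpM2l ?cabs_ge0.
by rewrite hornerZ cabsM ler_wpM2l ?cabs_ge0 ?P2.
Qed.

Lemma smallN e P : small e P -> small e (- P).
Proof. by move=> /(smallZ (-1)); rewrite cabsN cabs1 mul1r scaleN1r. Qed.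

(** Invertibility in the completion of the polynomials, expressed with polynomials only. *)
Definition approx_unit p := forall e, 0 < e -> exists P, small e (1 - p * P).

Lemma approx_unit1 : approx_unit 1.
Proof.
move=> e /ltW e0; exists 1; rewrite mulr1 subrr -(scale0r 1).
by apply: small_le e0 _; rewrite -[0](mul0r 1) -{1}cabs0; apply: smallZ small1.
Qed.

Lemma approx_unitM p q : approx_unit p -> approx_unit q -> approx_unit (p * q).
Proof.
move=> pu qu e e0; pose e' := Num.min 1 (e / 3).
have e'0 : 0 < e' by rewrite lt_min ltr01 divr_gt0.
have [P pP] := pu _ e'0; have [Q qQ] := qu _ e'0; exists (P * Q).
rewrite (_ : 1 - p * q * (P * Q) =
   (1 - p * P) + (1 - q * Q) + - ((1 - p * P) * (1 - q * Q))); last by ring.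
apply: small_le (smallD (smallD pP qQ) (smallN (smallM pP qQ))).
have : e' * e' <= e' by rewrite ler_piMl ?(ltW e'0)// ge_min lexx.
have : e' <= e / 3 by rewrite ge_min lexx orbT.
lra.
Qed.

Lemma approx_unit_prod (I : eqType) (r : seq I) (F : I -> {poly R[i]}) :
  (forall i, i \in r -> approx_unit (F i)) -> approx_unit (\prod_(i <- r) F i).
Proof.
elim: r => [|i r IH] h; first by rewrite big_nil; exact: approx_unit1.
rewrite big_cons; apply: approx_unitM; first by apply: h; rewrite inE eqxx.
by apply: IH => j jr; apply: h; rewrite inE jr orbT.
Qed.

(** This controls the size of an approximate inverse of [p] by 1 / [d], independently of how
    accurate the inverse is. *)
Definition bounded_below d p := forall e P, small e (p * P) -> small (e / d) P.

(* Neumann series: the perturbed remainder is still a contraction. *)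
Lemma approx_unit_step d p c : bounded_below d p -> cabs c < d ->
  approx_unit p -> approx_unit (p + c%:P).
Proof.
move=> pd cd pu e e0.
have d0 : 0 < d by exact: le_lt_trans (cabs_ge0 _) cd.
pose r := cabs c / d; have r1 : r < 1 by rewrite ltr_pdivrMr ?mul1r.
have r0 : 0 <= r by rewrite divr_ge0 ?cabs_ge0 ?ltW.
(* The new defect is at most e' + r (1 + e') <= r + 2 e' = (1 + r) / 2 < 1, so its powers tend to
   0. *)
pose e' := (1 - r) / 4.
have e'0 : 0 < e' by rewrite divr_gt0// subr_gt0.
have [P pP] := pu _ e'0.
pose E := 1 - (p + c%:P) * P; pose q := e' + cabs c * ((1 + e') / d).
have Esm : small q E.
  rewrite (_ : E = (1 - p * P) + - (c *: P)); last by rewrite -mul_polyC /E; ring.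
  apply: smallD => //; apply/smallN/smallZ/pd.
  rewrite (_ : p * P = 1 + - (1 - p * P)); last by ring.
  by apply: smallD; [exact: small1|exact: smallN].
have q0 : 0 <= q.
  apply: addr_ge0; first exact: ltW.
  by rewrite mulr_ge0 ?cabs_ge0// divr_ge0 ?(ltW d0)// addr_ge0// ltW.
have q1 : q < 1.
  have -> : q = e' + r * (1 + e') by rewrite /q /r; ring.
  have : r * e' <= e' by rewrite ler_piMl ?ltW.
  move: r1; rewrite /e'; move: (r) => x x1 x2; lra.
have [n qn] : exists n, q ^+ n <= e.
  have /cvgrPdist_le/(_ _ e0)[n _ /(_ n (leqnn n))] : q ^+ n @[n --> \oo] --> 0.
    by apply: cvg_expr; rewrite ger0_norm.
  by rewrite sub0r normrN ger0_norm ?exprn_ge0// => ?; exists n.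
exists (P * \sum_(i < n) E ^+ i).
rewrite (_ : 1 - _ = E ^+ n); last first.
  have -> : (p + c%:P) * (P * \sum_(i < n) E ^+ i) = (1 - E) * \sum_(i < n) E ^+ i.
    by rewrite mulrA /E; congr (_ * _); ring.
  by rewrite -[1 - E]opprB mulNr -subrX1 opprB subKr.
exact: small_le qn (smallX _ Esm).
Qed.

(** Multiplication by ['X] scales the l1 norm by exactly [rho], hence multiplication by ['X - w%:P]
    shrinks it at most by the factor |w| - [rho]. *)
Lemma bounded_belowXsubC d w : 0 < d -> rho + d <= cabs w ->
  (forall z, T z -> d <= cabs (z - w)) -> bounded_below d ('X - w%:P).
Proof.
move=> d0 dw dT e P [h1 h2]; split; last first.
  move=> z Tz; rewrite ler_pdivlMr//; apply: le_trans (h2 _ Tz).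
  by rewrite hornerM hornerXsubC cabsM mulrC ler_wpM2r ?cabs_ge0 ?dT.
rewrite ler_pdivlMr//.
have : cabs w * l1norm P <= e + rho * l1norm P.
  rewrite -l1normZ -l1normMX (_ : w *: P = - (('X - w%:P) * P) + P * 'X).
    apply: le_trans (l1normD _ _) _; rewrite lerD2r.
    by rewrite -scaleN1r l1normZ cabsN cabs1 mul1r.
  by rewrite -mul_polyC; ring.
have : (rho + d) * l1norm P <= cabs w * l1norm P by rewrite ler_wpM2r ?l1norm_ge0.
rewrite mulrDl; lra.
Qed.

(** The inverse of z - w is expanded in powers of z / w; the geometric series converges in both
    seminorms because [rho] < 1 and |z| <= 1 on [T]. *)
Lemma approx_unit_far w : 1 < cabs w -> approx_unit ('X - w%:P).
Proof.
move=> w1 e e0.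
have w0 : w != 0 by apply: contraTneq w1 => ->; rewrite cabs0 -leNgt.
have [n wn] : exists n, cabs w^-1 ^+ n <= e.
  have /cvgrPdist_le/(_ _ e0)[n _ /(_ n (leqnn n))] :
      cabs w^-1 ^+ n @[n --> \oo] --> 0.
    apply: cvg_expr; rewrite ger0_norm ?cabs_ge0// cabsV invf_lt1//.
    exact: lt_trans w1.
  by rewrite sub0r normrN ger0_norm ?exprn_ge0 ?cabs_ge0// => ?; exists n.
exists (- (w^-1) *: \sum_(i < n) (w^-1 *: 'X) ^+ i).
have -> : ('X - w%:P) * (- (w^-1) *: \sum_(i < n) (w^-1 *: 'X) ^+ i)
    = - ((w^-1 *: 'X - 1) * \sum_(i < n) (w^-1 *: 'X) ^+ i).
  rewrite -scalerAr scalerAl scaleNr scalerBr mulNr.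
  by rewrite -[w^-1 *: w%:P]mul_polyC -polyCM mulVf.
rewrite -subrX1 opprK addrC subrK.
apply: small_le wn _; apply: smallX; rewrite -[cabs _]mulr1; apply: smallZ; split=> [|z /T_le1]; last by rewrite hornerX.
case: small1 => /(ler_wpM2l rho_ge0) h _; rewrite -['X]mul1r l1normMX.
by apply: le_trans h _; rewrite mulr1 ltW.
Qed.

End PolynomialRunge.

(** * Pole pushing, and polynomials close to 1 on an arc but small on a disc *)

Section PolynomialPeak.
Context {R : realType}.
Variables (rho a s : R) (T : set R[i]).
Hypotheses (rho_ge0 : 0 <= rho) (rho_lt1 : rho < 1).
Hypothesis T_le1 : forall z, T z -> cabs z <= 1.
Local Notation approx_unit := (approx_unit rho T).

(** Starting from the far end, the pole is carried back to [w] in steps of [v]. Each step uses the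
    lower bound at the pole already treated, so the distances are required at [w + v *+ k.+1] and
    not at [w] itself. *)
Lemma approx_unit_path w v d N : 0 < d -> cabs v < d ->
  (forall k, (k < N)%N -> rho + d <= cabs (w + v *+ k.+1)) ->
  (forall z k, T z -> (k < N)%N -> d <= cabs (z - (w + v *+ k.+1))) ->
  1 < cabs (w + v *+ N) -> approx_unit ('X - w%:P).
Proof.
move=> d0 vd; elim: N w => [|N IH] w dw dT wN.
  by apply: (approx_unit_far rho_ge0 rho_lt1 T_le1); rewrite mulr0n addr0 in wN.
rewrite (_ : 'X - w%:P = 'X - (w + v)%:P + v%:P); last by rewrite polyCD; ring.
apply: (approx_unit_step rho_ge0 (d := d)) => //.
  apply: (bounded_belowXsubC rho_ge0) => // [|z Tz]; first exact: (dw 0).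
  exact: (dT _ 0).
apply: IH => [k kN|z k Tz kN|].
- by rewrite -addrA -mulrS; exact: (dw k.+1).
- by rewrite -addrA -mulrS; exact: (dT _ k.+1).
- by rewrite -addrA -mulrS.
Qed.

Hypotheses (rho_s : rho < s) (s_a : s < a).
Hypothesis T_Re : forall z, T z -> a <= complex.Re z.

(* Moving the pole vertically away from the real axis increases its modulus and
   keeps it on the left of [T]. *)
Lemma approx_unit_circle w : cabs w = s -> approx_unit ('X - w%:P).
Proof.
move=> ws; pose d := Num.min (s - rho) (a - s).
have d0 : 0 < d by rewrite lt_min !subr_gt0 rho_s.
have [d1 d2] : d <= s - rho /\ d <= a - s by rewrite !ge_min !lexx orbT.
clearbody d.
pose y := (if 0 <= complex.Im w then 1 else -1) * (d / 2).
have y2 : y ^+ 2 = (d / 2) ^+ 2.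
  by rewrite /y; case: ifP => _; ring.
have wy : 0 <= complex.Im w * y.
  rewrite /y; case: (leP 0 (complex.Im w)) => [w0|/ltW w0] /=.
    by rewrite mul1r mulr_ge0 ?divr_ge0 ?(ltW d0).
  by rewrite mulN1r mulrN -mulNr mulr_ge0 ?oppr_ge0 ?divr_ge0 ?(ltW d0).
have E k : w + (0 +i* y)%C *+ k = (complex.Re w +i* (complex.Im w + y *+ k))%C.
  elim: k => [|k IH]; first by rewrite !mulr0n !addr0; case: (w).
  by rewrite !mulrS addrCA IH; congr (_ +i* _)%C; ring.
have cE k : cabs (w + (0 +i* y)%C *+ k) ^+ 2 = s ^+ 2 + complex.Im w * y *+ k *+ 2 + (y *+ k) ^+ 2.
  rewrite E cabs_sqr/= -ws cabs_sqr sqrrD mulrnAr; ring.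
have ge_s k : s <= cabs (w + (0 +i* y)%C *+ k).
  rewrite -ler_sqr ?nnegrE ?cabs_ge0 -?ws ?cabs_ge0// cE ws -addrA lerDl.
  by rewrite addr_ge0 ?sqr_ge0 ?mulrn_wge0.
(* After N steps of length d / 2 the vertical displacement exceeds 1, so the pole has left the unit
   disc. *)
pose N := (Num.bound (2 / d)).+1.
apply: (@approx_unit_path w (0 +i* y)%C d N) => //.
- rewrite -ltr_sqr ?nnegrE ?cabs_ge0 ?(ltW d0)// cabs_sqr/= expr0n add0r y2.
  by rewrite ltr_sqr ?nnegrE; lra.
- by move=> k _; apply: le_trans (ge_s _); lra.
- move=> z k /T_Re az _; rewrite E; apply: le_trans (Re_le_cabs _).
  case: z az => zr zi /= az; apply: le_trans (ler_norm _).
  have := Re_le_cabs w; rewrite ws => /(le_trans (ler_norm _)).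
  by move: (complex.Re w) => x; lra.
- rewrite -ltr_sqr ?nnegrE ?cabs_ge0 ?ler01// cE expr1n.
  suff : 1 < (y *+ N) ^+ 2.
    by move=> h; apply: lt_le_trans h _; rewrite lerDr addr_ge0 ?sqr_ge0 ?mulrn_wge0.
  rewrite -mulr_natr exprMn y2 -exprMn expr_gt1 ?mulr_ge0 ?divr_ge0 ?(ltW d0)//.
  rewrite -ltr_pdivrMl ?divr_gt0// mulr1 invf_div.
  apply: lt_trans (archi_boundP _) _; first by rewrite divr_ge0 ?(ltW d0).
  by rewrite ltr_nat.
Qed.

(** All roots of p = ['X^J] - s^J lie on the circle |w| = s, so p has an approximate inverse Q. On
    [T] the value z^J / (z^J - s^J) is near 1 because s^J is small. In the l1 norm, s^J Q = ['X^J] Q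
    - p Q together with [rho] < s bounds s^J Q, and ['X^J] Q is smaller by the factor (rho / s)^J.
    The lower bound [K] on J serves to discard the powers of too low frequency. *)
Lemma polynomial_peak (e : R) (K : nat) : 0 < e -> s < 1 ->
  (forall z, T z -> cabs z = 1) ->
  exists J (Q : {poly R[i]}), [/\ (K <= J)%N, l1norm rho ('X^J * Q) <= e &
    forall z, T z -> cabs (('X^J * Q).[z] - 1) <= e].
Proof.
move=> e0 s1 T1.
have s0 : 0 < s by exact: le_lt_trans rho_s.
(* The bound 1/2 yields the estimate 4 for the l1 norm of s^J Q and for |Q| on [T]; multiplied by e
   / 12 each leaves e / 3. *)
have [J [KJ J1 J2]] : exists J, [/\ (K <= J)%N, s ^+ J <= Num.min (1/2) (e / 12) & (rho / s) ^+ J <= Num.min (1/2) (e / 12)].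
  have m0 : 0 < Num.min (1/2) (e / 12) by rewrite lt_min !divr_gt0.
  have C1 : (s ^+ n @[n --> \oo] --> (0:R)) by apply: cvg_expr; rewrite ger0_norm ?ltW.
  have C2 : ((rho / s) ^+ n @[n --> \oo] --> (0:R)).
    by apply: cvg_expr; rewrite ger0_norm ?divr_ge0 ?(ltW s0)// ltr_pdivrMr ?mul1r.
  have /cvgrPdist_le/(_ _ m0)[n1 _ h1] := C1.
  have /cvgrPdist_le/(_ _ m0)[n2 _ h2] := C2.
  exists (K + n1 + n2)%N; split; first by rewrite -addnA leq_addr.
    have := h1 (K + n1 + n2)%N; rewrite /= sub0r normrN ger0_norm ?exprn_ge0 ?(ltW s0)//.
    by apply; rewrite addnAC leq_addl.
  have := h2 (K + n1 + n2)%N; rewrite /= sub0r normrN ger0_norm ?exprn_ge0 ?divr_ge0 ?(ltW s0)//.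
  by apply; rewrite leq_addl.
have J0 : (0 < J)%N by case: J J1 {J2 KJ} => //; rewrite expr0 le_min => /andP[]; lra.
pose p : {poly R[i]} := 'X^J - ((s ^+ J)%:C)%C%:P.
have pu : approx_unit p.
  have [r pr] := closed_field_poly_normal p.
  have lp : lead_coef p = 1.
    rewrite lead_coefDl ?lead_coefXn// size_polyXn size_polyN size_polyC.
    by rewrite (leq_ltn_trans (leq_b1 _)).
  rewrite pr lp scale1r; apply: (approx_unit_prod rho_ge0) => w wr.
  apply: approx_unit_circle; have : root p w by rewrite pr lp scale1r root_prod_XsubC.
  rewrite /root hornerD hornerN hornerXn hornerC subr_eq0 => /eqP/(congr1 (@cabs R)).
  rewrite cabsX cabsR ger0_norm ?exprn_ge0 ?(ltW s0)// => /eqP.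
  by rewrite eqrXn2 ?cabs_ge0 ?(ltW s0)// => /eqP.
have m0 : 0 < Num.min 1 (e / 2) by rewrite lt_min ltr01 divr_gt0.
have [Q [Q1 Q2]] := pu _ m0.
have Qe : l1norm rho (1 - p * Q) <= 1 by apply: le_trans Q1 _; rewrite ge_min lexx.
exists J, Q; split=> //.
  have pQ : l1norm rho (p * Q) <= 2.
    rewrite (_ : p * Q = 1 + (-1) *: (1 - p * Q)); last by rewrite scaleN1r; ring.
    apply: le_trans (l1normD rho_ge0 _ _) _; rewrite l1normZ cabsN cabs1 mul1r.
    by have [h _] := small1 rho T; move: h Qe; lra.
  have : s ^+ J * l1norm rho Q <= rho ^+ J * l1norm rho Q + 2.
    rewrite -l1normMXn -[s ^+ J]ger0_norm ?exprn_ge0 ?(ltW s0)// -cabsR -l1normZ.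
    rewrite (_ : _ *: Q = Q * 'X^J + (-1) *: (p * Q)).
      apply: le_trans (l1normD rho_ge0 _ _) _; rewrite lerD2l.
      by rewrite l1normZ cabsN cabs1 mul1r.
    by rewrite -mul_polyC scaleN1r /p; ring.
  have -> : rho ^+ J = (rho / s) ^+ J * s ^+ J.
    by rewrite -exprMn divfK ?lt0r_neq0.
  rewrite ['X^J * Q]mulrC l1normMXn.
  have -> : rho ^+ J = (rho / s) ^+ J * s ^+ J.
    by rewrite -exprMn divfK ?lt0r_neq0.
  have : 0 <= s ^+ J * l1norm rho Q by rewrite mulr_ge0 ?exprn_ge0 ?(ltW s0) ?l1norm_ge0.
  move: J2; rewrite -!mulrA; move: ((rho / s) ^+ J) (s ^+ J * _) => r x.
  rewrite le_min => /andP[r1 r2] x0 xr.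
  have rx : r * x <= 1/2 * x by rewrite ler_wpM2r.
  have x4 : x <= 4 by lra.
  apply: le_trans (ler_wpM2r x0 r2) _.
  by apply: le_trans (ler_wpM2l _ x4) _; lra.
move=> z Tz; have := Q2 _ Tz; rewrite le_min => /andP[q1 q2].
move: J1; rewrite le_min => /andP[S1 S2].
have S0 : 0 <= s ^+ J by rewrite exprn_ge0 ?(ltW s0).
move: q1 q2; rewrite !hornerE cabsB.
have zJ : cabs (z ^+ J) = 1 by rewrite cabsX T1// expr1n.
set q := Q.[z] => q1 q2.
have qS : cabs (z ^+ J * q - 1) <=
    cabs ((z ^+ J - (s ^+ J)%:C%C) * q - 1) + s ^+ J * cabs q.
  have -> : z ^+ J * q - 1 =
      (z ^+ J - (s ^+ J)%:C%C) * q - 1 + (s ^+ J)%:C%C * q by ring.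
  by apply: le_trans (cabsD _ _) _; rewrite cabsM cabsR ger0_norm.
have q4 : cabs q <= 4.
  have : cabs q <= cabs (z ^+ J * q - 1) + 1.
    have -> : cabs q = cabs (z ^+ J * q) by rewrite cabsM zJ mul1r.
    rewrite -{1}[z ^+ J * q](subrK 1).
    by apply: le_trans (cabsD _ _) _; rewrite cabs1.
  have : s ^+ J * cabs q <= 1/2 * cabs q by rewrite ler_wpM2r ?cabs_ge0.
  lra.
apply: le_trans qS _.
have : s ^+ J * cabs q <= (e / 12) * 4 by rewrite ler_pM ?cabs_ge0.
lra.
Qed.

End PolynomialPeak.

(** * Interpolation of exponentials *)

Section ExponentialTaylor.
Context {R : realType}.
Implicit Types (x y : R) (n : nat).

Lemma is_derive_horner (p : {poly R}) y : is_derive y 1 (horner p) (p^`()).[y].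
Proof. by apply: DeriveDef; [exact: derivable_horner|rewrite derivE derive1E]. Qed.

Lemma fact_invS m : (m.+1)`!%:R^-1 *+ m.+1 = m`!%:R^-1 :> R.
Proof. by rewrite factS natrM invfM -[LHS]mulr_natr mulrAC mulVf ?mul1r ?pnatr_eq0. Qed.

Lemma is_derive_pow_fact n y :
  is_derive y 1 (fun y : R => y ^+ n.+1 / (n.+1)`!%:R) (y ^+ n / n`!%:R).
Proof.
have := is_derive_horner ((n.+1)`!%:R^-1 *: 'X^(n.+1)) y.
rewrite (_ : horner _ = fun y : R => y ^+ n.+1 / (n.+1)`!%:R); last first.
  by apply/funext => z; rewrite !hornerE mulrC.
by rewrite derivZ derivXn hornerZ hornerMn hornerXn mulrnAr -mulrnAl fact_invS mulrC.
Qed.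

(** Mean value theorem for x^(n+1) / (n+1)! minus f, whose derivative is nonnegative on the positive
    axis, and for the same with -f. *)
Lemma integrated_bound (f f' : R -> R) n x :
  (forall y, is_derive y 1 f (f' y)) -> f 0 = 0 ->
  (forall y, 0 <= y -> `|f' y| <= y ^+ n / n`!%:R) ->
  0 <= x -> `|f x| <= x ^+ n.+1 / (n.+1)`!%:R.
Proof.
move=> df f0 f'le x0.
have main (g g' : R -> R) : (forall y, is_derive y 1 g (g' y)) -> g 0 = 0 ->
    (forall y, 0 <= y -> `|g' y| <= y ^+ n / n`!%:R) ->
    g x <= x ^+ n.+1 / (n.+1)`!%:R.
  move=> dg g0 g'le; pose h := (fun y : R => y ^+ n.+1 / (n.+1)`!%:R) - g.
  have dh y : is_derive y 1 h (y ^+ n / n`!%:R - g' y).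
    by have := is_derive_pow_fact n y; have := dg y => ? ?; exact: is_deriveB.
  have [|c] := @MVT_segment R h _ 0 x x0 (fun y _ => dh y).
    by apply: derivable_within_continuous => y _; case: (dh y).
  rewrite in_itv /= => /andP[c0 _] E; rewrite -subr_ge0.
  have -> : x ^+ n.+1 / (n.+1)`!%:R - g x = h x - h 0.
    by rewrite /h /= !fctE expr0n/= mul0r g0 !subr0.
  rewrite E subr0 mulr_ge0// subr_ge0.
  exact: le_trans (ler_norm _) (g'le _ c0).
rewrite ler_norml lerNl; apply/andP; split; last exact: (main f f').
apply: (main (- f) (fun y => - f' y)) => //=.
- by rewrite -[LHS]/(- f 0) f0 oppr0.
- by move=> y y0; rewrite normrN f'le.
Qed.

Definition expi_poly (N : nat) : {poly R[i]} :=
  \poly_(m < N) ((- 'i%C) ^+ m / m`!%:R).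

Lemma expi_taylor N x : 0 <= x ->
  cabs (expi (- x) - (expi_poly N).[x%:C%C]) <= 2 * (x ^+ N / N`!%:R).
Proof.
pose c m : R := complex.Re ((- 'i%C) ^+ m).
pose d m : R := complex.Im ((- 'i%C) ^+ m).
pose C n : {poly R} := \poly_(m < n) (c m / m`!%:R).
pose D n : {poly R} := \poly_(m < n) (d m / m`!%:R).
have iE m : (- 'i%C) ^+ m = (c m +i* d m)%C by rewrite /c /d; case: (_ ^+ _).
have cS m : c m.+1 = d m.
  by rewrite {1}/c exprS iE /=; ring.
have dS m : d m.+1 = - c m.
  by rewrite {1}/d exprS iE /=; ring.
have C' n : (C n.+1)^`() = D n.
  apply/polyP => m; rewrite coef_deriv !coef_poly ltnS.
  by case: ifP; rewrite ?mul0rn// cS -mulrnAr fact_invS.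
have D' n : (D n.+1)^`() = - C n.
  apply/polyP => m; rewrite coef_deriv coefN !coef_poly ltnS.
  by case: ifP; rewrite ?oppr0 ?mul0rn// dS -mulrnAr fact_invS mulNr.
have p0 (p : {poly R}) : p.[0] = p`_0 by rewrite horner_coef0.
(* The derivative of either remainder of order n + 1 is, up to sign, the other remainder of order n,
   so one induction bounds both. *)
have key n y : 0 <= y -> `|cos y - (C n).[y]| <= y ^+ n / n`!%:R /\
                         `|- sin y - (D n).[y]| <= y ^+ n / n`!%:R.
  elim: n y => [|n IH] y y0.
    rewrite expr0 fact0 divr1 /C /D !poly_def !big_ord0 !horner0 !subr0 normrN.
    by rewrite !ler_norml cos_geN1 cos_le1 sin_geN1 sin_le1.
  split.
    apply: (@integrated_bound (@cos R - horner (C n.+1)) (fun y => - sin y - (D n).[y])) => //.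
    + by move=> z; rewrite -C'; have := is_derive_horner (C n.+1) z => ?; exact: is_deriveB.
    + by rewrite /= !fctE cos0 p0 coef_poly /= /c expr0 fact0 -[complex.Re 1]/1 divr1 subrr.
    + by move=> z z0; have [_] := IH z z0.
  apply: (@integrated_bound (- @sin R - horner (D n.+1)) (fun y => - (cos y - (C n).[y]))) => //.
  + move=> z; have := is_derive_horner (D n.+1) z => ?.
    by rewrite opprB addrC -[(C n).[z]]opprK -hornerN -D'; exact: is_deriveB.
  + by rewrite /= !fctE sin0 p0 coef_poly /= /d expr0 -[complex.Im 1]/0 mul0r oppr0 addr0.
  + by move=> z z0; have [] := IH z z0; rewrite normrN.
move=> x0; have [k1 k2] := key N x x0.
have -> : expi (- x) - (expi_poly N).[x%:C%C] =
    ((cos x - (C N).[x]) +i* (- sin x - (D N).[x]))%C.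
  have -> : (expi_poly N).[x%:C%C] = ((C N).[x] +i* (D N).[x])%C.
    rewrite /expi_poly /C /D !horner_poly; apply/eqP; rewrite eq_complex Re_sum Im_sum.
    have E m : (- 'i%C) ^+ m / m`!%:R * x%:C%C ^+ m =
        (c m +i* d m)%C * (m`!%:R^-1 * x ^+ m)%:C%C.
      by rewrite iE rmorphM rmorphXn fmorphV rmorph_nat mulrA.
    apply/andP; split; apply/eqP; apply: eq_bigr => m _; rewrite E /=; ring.
  by rewrite /expi cosN sinN.
apply: le_trans (cabs_le_ReIm _) _ => /=.
by rewrite mulr_natl mulr2n lerD.
Qed.

End ExponentialTaylor.

(** * Lagrange weights at nodes in separated unit windows *)

Section LagrangeWeights.
Context {R : realType}.
Implicit Types (y : nat -> R) (N : nat).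

(* Weights of the interpolation formula that evaluates at 0 from the nodes [y]. *)
Definition lagrange_weight N y (j : nat) : R :=
  (\prod_(i < N | (i : nat) != j) ('X - (y i)%:P)).[y j]^-1 *
  (\prod_(i < N | (i : nat) != j) ('X - (y i)%:P)).[0].

Lemma lagrange_weight_sum N y m : injective y -> (m < N)%N ->
  \sum_(j < N) lagrange_weight N y j * y j ^+ m = (m == 0%N)%:R.
Proof.
move=> yi mN; have N0 : (0 < N)%N by exact: leq_ltn_trans mN.
have sX : (size ('X^m : {poly R}) <= N)%N by rewrite size_polyXn.
have := congr1 (fun p : {poly R} => p.[0]) (lagrange_gen N0 yi sX).
rewrite /= hornerXn expr0n horner_sum => ->; apply: eq_bigr => j _.
by rewrite hornerM hornerC hornerXn lagrangeE// hornerM hornerC mulrC.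
Qed.

Lemma bin_le_exp2 n k : ('C(n, k) <= 2 ^ n)%N.
Proof.
elim: n k => [|n IH] [|k]; rewrite ?bin0 ?expn_gt0// binS.
by rewrite expnS mul2n -addnn leq_add.
Qed.

Lemma prod_odd_le j : \prod_(i < j) (2 * i%:R + 1) <= 2 ^+ j * j`!%:R :> R.
Proof.
elim: j => [|j IH]; first by rewrite big_ord0 expr0 fact0 mulr1.
rewrite big_ord_recr/= [leRHS](_ : _ = 2 ^+ j * j`!%:R * (2 * j.+1%:R)); last first.
  by rewrite exprSr factS natrM; ring.
rewrite ler_pM ?prodr_ge0 ?addr_ge0 ?mulr_ge0//; last by rewrite -natr1; lra.
Qed.

Lemma prod_dist_fact j : \prod_(i < j) (j%:R - i%:R) = j`!%:R :> R.
Proof.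
elim: j => [|j IH]; first by rewrite big_ord0 fact0.
rewrite big_ord_recl factS natrM subr0 -IH; congr (_ * _).
by apply: eq_bigr => i _; rewrite lift0 -!natr1; ring.
Qed.

Lemma prod_odd_shift_le j k :
  \prod_(i < k) ((2 * (j + i)%:R + 3) / i.+1%:R) <= 2 ^+ k * 'C(j.+1 + k, k)%:R :> R.
Proof.
elim: k => [|k IH]; first by rewrite big_ord0 bin0 mulr1.
rewrite big_ord_recr/=.
apply: le_trans (_ : _ <= 2 ^+ k * 'C(j.+1 + k, k)%:R * (2 * (j + k).+2%:R / k.+1%:R)) _.
  rewrite ler_pM ?prodr_ge0 ?divr_ge0 ?addr_ge0 ?mulr_ge0//.
  by rewrite ler_pM2r ?invr_gt0 ?ltr0n// -!natr1; lra.
rewrite -[2 * _ / _]mulrA mulrACA -exprSr ler_wpM2l ?exprn_ge0// mulrA ler_pdivrMr ?ltr0n//.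
rewrite -!natrM ler_nat mulnC [leqRHS]mulnC.
by have := mul_bin_diag (j.+1 + k.+1) k; rewrite addnS addSn/= => ->.
Qed.

(** The gaps between the windows give |y_i - y_j| >= |i - j|, so each factor is at most (2i + 1) /
    |i - j|. The j factors below j contribute at most [2 ^+ j], the k factors above it at most
    [2 ^+ k] times a binomial coefficient that is at most [2 ^+ (j.+1 + k)]; with N = j + 1 + k the
    total stays below [4 ^+ N]. *)
Lemma lagrange_weight_le N y j : (j < N)%N ->
  (forall i : nat, 2 * i%:R < y i <= 2 * i%:R + 1) ->
  `|lagrange_weight N y j| <= 4 ^+ N.
Proof.
move=> jN yb; rewrite /lagrange_weight !horner_prod normrM normfV !normr_prod -prodfV -big_split/=.
have le1 i : i != j -> `|('X - (y i)%:P).[y j]|^-1 * `|('X - (y i)%:P).[0]|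
    <= (2 * i%:R + 1) / `|i%:R - j%:R|.
  move=> ij; rewrite !hornerXsubC sub0r normrN mulrC.
  have [/andP[i1 i2] /andP[j1 j2]] := (yb i, yb j).
  have i0 : (0:R) <= i%:R by [].
  rewrite ler_pM ?invr_ge0//; first by rewrite ger0_norm; lra.
  have [ltij|ltji|/eqP] := ltngtP i j; last by rewrite (negPf ij).
    have : i.+1%:R <= j%:R :> R by rewrite ler_nat.
    rewrite -natr1 => h; rewrite lef_pV2 ?posrE.
    - by rewrite ler0_norm ?ger0_norm; lra.
    - by rewrite gtr0_norm; lra.
    - by rewrite ltr0_norm; lra.
  have : j.+1%:R <= i%:R :> R by rewrite ler_nat.
  rewrite -natr1 => h; rewrite lef_pV2 ?posrE.
  - by rewrite ger0_norm ?ler0_norm; lra.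
  - by rewrite ltr0_norm; lra.
  - by rewrite gtr0_norm; lra.
apply: le_trans (_ : \prod_(i < N | (i:nat) != j) ((2 * i%:R + 1) / `|i%:R - j%:R|) <= _).
  apply: ler_prod => i ij; apply/andP; split; last exact: le1.
  by rewrite mulr_ge0 ?invr_ge0.
have -> : N = (j + (1 + (N - j.+1)))%N by lia.
move: (N - j.+1)%N => k {le1 jN N}.
rewrite big_split_ord/= big_split_ord/= [X in X * _](_ : _ =
    \prod_(i < j) ((2 * i%:R + 1) / (j%:R - i%:R))); last first.
  rewrite big_mkcond; apply: eq_bigr => i _.
  by rewrite ltn_eqF// distrC ger0_norm// subr_ge0 ler_nat ltnW.
rewrite [X in _ * (X * _)]big1 ?mul1r => [|i]; last by rewrite ord1 addn0 eqxx.
rewrite [X in _ * X](_ : _ =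
    \prod_(i < k) ((2 * (j + i)%:R + 3) / i.+1%:R)); last first.
  rewrite big_mkcond; apply: eq_bigr => i _ /=.
  rewrite add1n gtn_eqF ?addnS ?ltnS ?leq_addr//= -addnS.
  have -> : (j + i.+1)%:R - j%:R = i.+1%:R :> R by rewrite natrD; ring.
  rewrite ger0_norm//; congr (_ / _); rewrite addnS -natr1; ring.
rewrite prodf_div prod_dist_fact.
apply: le_trans (_ : 2 ^+ j * (2 ^+ k * 2 ^+ (j.+1 + k)) <= _).
  apply: ler_pM; rewrite ?prodr_ge0 ?divr_ge0 ?prodr_ge0//.
  - by rewrite ler_pdivrMr ?prod_odd_le// ltr0n fact_gt0.
  - apply: le_trans (prod_odd_shift_le _ _) _.
    by rewrite ler_wpM2l ?exprn_ge0// -natrX ler_nat bin_le_exp2.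
rewrite -!exprD (_ : 4 = 2 ^+ 2)//; last by ring.
by rewrite -exprM ler_weXn2l ?ler1n//; lia.
Qed.

(** The weights are exact on the Taylor polynomial of degree below [N], whose value at 0 is 1. What
    remains is the Taylor remainder at nodes in [0, 2N], multiplied by [N] weights of size at most
    [4 ^+ N]. *)
Lemma lagrange_expi N y u : (0 < N)%N -> 0 <= u ->
  (forall i : nat, 2 * i%:R < y i <= 2 * i%:R + 1) ->
  cabs (\sum_(j < N) (lagrange_weight N y j)%:C%C * expi (- (u * y j)) - 1) <=
  N%:R * (4 ^+ N * (2 * ((u * (2 * N%:R)) ^+ N / N`!%:R))).
Proof.
move=> N0 u0 yb.
have yi : injective y.
  move=> i j E; have := yb i; have := yb j; rewrite E => /andP[j1 j2] /andP[i1 i2].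
  have : 2 * i%:R < 2 * j%:R + 1 :> R by lra.
  have : 2 * j%:R < 2 * i%:R + 1 :> R by lra.
  by rewrite -!natrM !natr1 !ltr_nat; lia.
have E1 : \sum_(j < N) (lagrange_weight N y j)%:C%C * (expi_poly N).[(u * y j)%:C%C]
    = 1 :> R[i].
  under eq_bigr do rewrite horner_poly mulr_sumr.
  rewrite exchange_big/=.
  transitivity (\sum_(m < N) (- 'i%C) ^+ m / m`!%:R * (u ^+ m * (nat_of_ord m == 0%N)%:R)%:C%C : R[i]).
    apply: eq_bigr => m _; rewrite -(lagrange_weight_sum yi (ltn_ord m)).
    rewrite rmorphM rmorph_sum/= mulr_sumr mulr_sumr; apply: eq_bigr => j _.
    rewrite !rmorphXn !rmorphM/= exprMn rmorphXn; ring.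
  rewrite (bigD1 (Ordinal N0))//= big1 ?addr0 => [|m].
    by rewrite !expr0 fact0 divr1 mulr1 mul1r.
  by rewrite -val_eqE/= => /negPf ->; rewrite mulr0 mulr0.
rewrite -{1}E1 -sumrB; apply: le_trans (cabs_sum _ _ _) _.
rewrite -[N%:R]/(N%:R) mulr_natl -[X in _ *+ X]card_ord -sumr_const.
apply: ler_sum => j _; rewrite -mulrBr cabsM cabsR.
have [y0 yN] : 0 <= y j /\ y j <= 2 * N%:R.
  have /andP[j1 j2] := yb j; split; first by have : (0:R) <= j%:R by []; lra.
  have : (j.+1)%:R <= N%:R :> R by rewrite ler_nat.
  by rewrite -natr1; lra.
rewrite ler_pM ?cabs_ge0 ?lagrange_weight_le//.
apply: le_trans (expi_taylor _ (mulr_ge0 u0 y0)) _.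
rewrite ler_wpM2l// ler_wpM2r ?invr_ge0//.
by rewrite lerXn2r ?nnegrE ?mulr_ge0// ler_wpM2l.
Qed.

End LagrangeWeights.

(** * Averages over independently drawn nodes *)

Section ProductAverage.
Context {R : realType} (N B : nat) (w : 'I_N -> 'I_B -> R).
Hypotheses (w_ge0 : forall i n, 0 <= w i n) (w_sum : forall i, \sum_n w i n = 1).
Implicit Types s : {ffun 'I_N -> 'I_B}.

(** Probability of the tuple [s] when its entries are independent, the i-th with law [w i]. *)
Definition product_weight s : R := \prod_i w i (s i).

Lemma product_weight_ge0 s : 0 <= product_weight s.
Proof. by apply: prodr_ge0 => i _. Qed.

Lemma product_weight_sum : \sum_s product_weight s = 1.
Proof. by rewrite -bigA_distr_bigA big1. Qed.

Lemma product_weight_marginal j n :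
  \sum_s product_weight s * (s j == n)%:R = w j n.
Proof.
transitivity (\sum_(s : {ffun 'I_N -> 'I_B}) \prod_i (w i (s i) * ((i == j) ==> (s i == n))%:R)).
  apply: eq_bigr => s _; rewrite big_split/=; congr (_ * _).
  rewrite (bigD1 j)//= eqxx/= big1 ?mulr1// => i /negPf ->.
  by [].
rewrite -(bigA_distr_bigA (fun i m => w i m * ((i == j) ==> (m == n))%:R)).
rewrite (bigD1 j)//= [X in _ * X]big1 => [|i /negPf ij]; last first.
  by under eq_bigr do rewrite ij mulr1; rewrite w_sum.
rewrite mulr1 (bigD1 n)//= !eqxx mulr1 big1 ?addr0// => m /negPf mn.
by rewrite mn mulr0.
Qed.

Variables (l : {ffun 'I_N -> 'I_B} -> 'I_N -> R).

(** Expected total weight that falls on the index [n]. *)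
Definition average_coef (n : 'I_B) : R :=
  \sum_s \sum_j product_weight s * (s j == n)%:R * l s j.

(** The bound on [l] is asked for on tuples of positive probability alone, because the Lagrange
    bound is available only when every node lies in its window. *)
Lemma average_coef_le C n :
  (forall s j, 0 < product_weight s -> `|l s j| <= C) ->
  `|average_coef n| <= C * \sum_j w j n.
Proof.
move=> lC; apply: le_trans (ler_norm_sum _ _ _) _.
apply: le_trans (_ : _ <= \sum_(s : {ffun 'I_N -> 'I_B}) \sum_j C * (product_weight s * (s j == n)%:R)) _.
  apply: ler_sum => s _; apply: le_trans (ler_norm_sum _ _ _) _.
  apply: ler_sum => j _; have := product_weight_ge0 s; rewrite le_eqVlt => /predU1P[<-|W0].
    by rewrite !mul0r mulr0 normr0.
  rewrite normrM [leRHS]mulrC ger0_norm ?mulr_ge0 ?ler_wpM2l ?mulr_ge0 ?(ltW W0)//.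
  exact: lC.
rewrite exchange_big/= mulr_sumr; apply: ler_sum => j _.
by rewrite -mulr_sumr product_weight_marginal.
Qed.

Lemma average_coef_sum (g : 'I_B -> R[i]) :
  \sum_n (average_coef n)%:C%C * g n =
  \sum_s (product_weight s)%:C%C * \sum_j (l s j)%:C%C * g (s j).
Proof.
transitivity (\sum_n \sum_(s : {ffun 'I_N -> 'I_B}) \sum_j
    (product_weight s)%:C%C * ((l s j)%:C%C * ((s j == n)%:R * g n))).
  apply: eq_bigr => n _; rewrite rmorph_sum mulr_suml; apply: eq_bigr => s _.
  rewrite rmorph_sum mulr_suml; apply: eq_bigr => j _.
  by rewrite !rmorphM rmorph_nat/=; ring.
rewrite exchange_big/=; apply: eq_bigr => s _.
rewrite exchange_big mulr_sumr/=; apply: eq_bigr => j _.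
rewrite (bigD1 (s j))//= eqxx mul1r big1 ?addr0// => n.
by rewrite eq_sym => /negPf ->; rewrite mul0r !mulr0.
Qed.

End ProductAverage.

(* The coefficients average Lagrange interpolation at one node per window over
   all choices of nodes, each node drawn with probability proportional to [A]. *)
Lemma window_interpolation {R : realType} (lam A : nat -> R) (N B : nat) (x d H m : R) :
  (0 < N)%N -> 0 < d -> 0 < m -> (forall n, 0 <= A n) ->
  (forall j, (j < N)%N ->
    m <= \sum_(n < B | x + d * (2 * j%:R) < lam n <= x + d * (2 * j%:R + 1)) A n) ->
  exists b : nat -> R,
    [/\ forall n, (n < B)%N -> `|b n| <= 4 ^+ N * (N%:R / m) * A n,
        forall n, lam n <= x -> b n = 0 &
        forall t, 0 <= t <= H ->
          cabs (\sum_(n < B) (b n)%:C%C * expi (- (lam n * t)) - expi (- (x * t))) <=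
          N%:R * (4 ^+ N * (2 * ((d * H * (2 * N%:R)) ^+ N / N`!%:R)))].
Proof.
move=> N0 d0 m0 A0 mass.
pose win (j : 'I_N) (n : 'I_B) :=
  x + d * (2 * j%:R) < lam n <= x + d * (2 * j%:R + 1).
pose S j := \sum_(n | win j n) A n.
have Sm j : m <= S j by exact: mass.
have S0 j : 0 < S j by exact: lt_le_trans (Sm j).
pose w j n := if win j n then A n / S j else 0.
have w0 j n : 0 <= w j n by rewrite /w; case: ifP => // _; rewrite divr_ge0 ?(ltW (S0 j)).
have w1 j : \sum_n w j n = 1.
  rewrite /w -big_mkcond -mulr_suml; exact: divff (lt0r_neq0 (S0 j)).
have wA j n : w j n <= A n / m.
  rewrite /w; case: ifP => _; last by rewrite divr_ge0 ?(ltW m0).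
  by rewrite ler_wpM2l ?lef_pV2 ?posrE.
(* The rescaling sends the j-th window to (2j, 2j + 1]. The default beyond [N] stays in its window
   too, since the Lagrange lemmas constrain the node sequence on all of [nat]. *)
pose y (s : {ffun 'I_N -> 'I_B}) (i : nat) : R :=
  if insub i is Some i' then (lam (s i') - x) / d else 2 * i%:R + 1.
have yE s (j : 'I_N) : y s j = (lam (s j) - x) / d by rewrite /y valK.
have winW s : 0 < product_weight w s -> forall j, win j (s j).
  move=> W0 j; apply: contraTT W0 => wj; rewrite /product_weight (bigD1 j)//=.
  by rewrite {1}/w (negPf wj) mul0r ltxx.
have yb s : 0 < product_weight w s ->
    forall i : nat, 2 * i%:R < y s i <= 2 * i%:R + 1.
  move=> W0 i; rewrite /y; case: insubP => [j _ <-|_]; last by rewrite lexx ltrDl ltr01.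
  have /andP[h1 h2] := winW s W0 j.
  by rewrite ltr_pdivlMr// ler_pdivrMr//; apply/andP; split; lra.
pose l s (j : 'I_N) := lagrange_weight N (y s) j.
have lC s j : 0 < product_weight w s -> `|l s j| <= 4 ^+ N.
  by move=> W0; rewrite lagrange_weight_le//; exact: yb.
exists (fun n => if insub n is Some n' then average_coef w l n' else 0); split.
- move=> n nB; rewrite insubT/=; apply: le_trans (average_coef_le w0 w1 _ lC) _.
  rewrite -mulrA ler_wpM2l ?exprn_ge0//.
  apply: le_trans (ler_sum _ (fun j _ => wA j _)) _.
  rewrite sumr_const card_ord -[leLHS]mulr_natr SubK.
  by rewrite le_eqVlt; apply/orP; left; apply/eqP; ring.
- move=> n nx; case: insubP => // n' _ n'n.
  have wn j : w j n' = 0.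
    rewrite /w /win n'n; case: ifP => // /andP[h _].
    have : 0 <= d * (2 * j%:R) by rewrite !mulr_ge0 ?(ltW d0).
    lra.
  apply/eqP; rewrite -normr_le0 (le_trans (average_coef_le w0 w1 _ lC))//.
  by rewrite big1 ?mulr0.
- move=> t /andP[t0 tH].
  under eq_bigr do rewrite valK.
  rewrite (average_coef_sum w l (fun n : 'I_B => expi (- (lam n * t)))).
  set E := (X in _ <= X).
  (* Written as its own average, the target turns the error into the average of the errors of single
     tuples. *)
  rewrite -[expi (- (x * t))]mul1r -[1 in X in _ - X * _](rmorph1 (real_complex R)).
  rewrite -(product_weight_sum w1) rmorph_sum mulr_suml -sumrB.
  apply: le_trans (cabs_sum _ _ _) _; have -> : E = \sum_s product_weight w s * E.
    by rewrite -mulr_suml product_weight_sum ?mul1r.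
  apply: ler_sum => s _; rewrite -mulrBr cabsM cabsR ger0_norm ?product_weight_ge0//.
  have := product_weight_ge0 w0 s; rewrite le_eqVlt => /predU1P[<-|W0].
    by rewrite !mul0r.
  rewrite ler_wpM2l ?(ltW W0)//.
  have -> : \sum_j (l s j)%:C%C * expi (- (lam (s j) * t)) - expi (- (x * t)) =
      (\sum_(j < N) (lagrange_weight N (y s) j)%:C%C * expi (- ((d * t) * y s j)) - 1)
      * expi (- (x * t)).
    rewrite mulrBl mul1r mulr_suml; congr (_ - _); apply: eq_bigr => j _.
    rewrite -[RHS]mulrA -expiD yE; congr (_ * expi _); field.
    exact: lt0r_neq0.
  rewrite cabsM cabs_expi mulr1.
  apply: le_trans (lagrange_expi N0 _ (yb s W0)) _; first by rewrite mulr_ge0 ?(ltW d0).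
  rewrite /E ler_wpM2l// ler_wpM2l ?exprn_ge0// ler_wpM2l// ler_wpM2r ?invr_ge0//.
  rewrite lerXn2r ?nnegrE ?mulr_ge0 ?(ltW d0)//; first exact: le_trans tH.
  by rewrite ler_wpM2r// ler_wpM2l ?(ltW d0).
Qed.

(** * Balancing the number of windows against their mass *)

Section ExponentialApproximation.
Context {R : realType}.

Lemma pow_le_expR_fact (N : nat) : N%:R ^+ N / N`!%:R <= expR 1 ^+ N :> R.
Proof.
rewrite -expRM_natr mul1r; case: N => [|N].
  by rewrite expr0 fact0 divr1 expR0.
have := @expR_ge1Dxn R N.+1%:R N (ler0n _ _); lra.
Qed.

Lemma natr_le_pow2 (N : nat) : N%:R <= 2 ^+ N :> R.
Proof. by rewrite -natrX ler_nat ltnW// ltn_expl. Qed.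

Lemma exponential_approximation (lam A : nat -> R) (H k : R) :
  (forall n, 0 <= A n) -> 0 < H -> 0 < k ->
  (forall d, 0 < d -> exists C X1 : R, 0 < C /\ forall X, X1 <= X ->
    exists B0, forall B : nat, (B0 <= B)%N ->
      C * expR (k * X) <= \sum_(n < B | X < lam n <= X + d) A n) ->
  exists K tau X1 : R, [/\ 0 < K, 0 < tau & forall x, X1 <= x ->
    exists B (b : nat -> R),
    [/\ forall n, (n < B)%N -> `|b n| <= K * expR (- (tau * x)) * A n,
        forall n, lam n <= x -> b n = 0 &
        forall t, 0 <= t <= H ->
          cabs (\sum_(n < B) (b n)%:C%C * expi (- (lam n * t)) - expi (- (x * t))) <=
          K * expR (- (tau * x))]].
Proof.
move=> A0 H0 k0 mass.
have e0 : 0 < expR 1 :> R by exact: expR_gt0.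
(* Chosen so that 2 * 4 * (2 d H) * e = 1/2: the factors bound N by [2 ^+ N], then the weights, the
   argument, and N^N / N! by e^N. *)
pose d : R := (32 * H * expR 1)^-1.
have d0 : 0 < d by rewrite invr_gt0 !mulr_gt0.
have [C [X1 [C0 hX1]]] := mass d d0.
have l8 : 0 < ln 8 :> R by rewrite ln_gt0; lra.
have l2 : 0 < ln 2 :> R by rewrite ln_gt0; lra.
(* With N about h x, the cost [8 ^+ N] is of order [expR (k * x / 2)], the square root of the growth
   of the window mass. *)
pose h := k / (2 * ln 8); have h0 : 0 < h by rewrite divr_gt0 ?mulr_gt0.
(* The first rate is the decay of the coefficients, the second that of the interpolation error. *)
pose tau := Num.min (k / 2) (h * ln 2).
have tau0 : 0 < tau by rewrite lt_min (divr_gt0 k0)// mulr_gt0.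
exists (8 / C + 2), tau, (Num.max 0 X1); split=> //.
  by rewrite addr_gt0 ?divr_gt0.
move=> x; rewrite ge_max => /andP[x0 xX1].
pose N := (Num.truncn (h * x)).+1.
have hx0 : 0 <= h * x by rewrite mulr_ge0 ?(ltW h0).
have N_gt : h * x < N%:R by exact: truncnS_gt.
have N_le : N%:R <= h * x + 1 by rewrite -natr1 lerD2r truncn_le.
have E8 : (8:R) ^+ N <= 8 * expR (k * x / 2).
  rewrite -{1}[8](@lnK R) ?posrE// -expRM_natr.
  apply: le_trans (_ : expR (ln 8 * (h * x + 1)) <= _); first by rewrite ler_expR ler_pM2l.
  rewrite mulrDr mulr1 expRD lnK ?posrE// mulrC ler_wpM2l// ler_expR /h.
  by rewrite le_eqVlt; apply/orP; left; apply/eqP; field; rewrite ?lt0r_neq0.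
have E2 : (2:R)^-1 ^+ N <= expR (- (h * ln 2 * x)).
  rewrite -{1}[2](@lnK R) ?posrE// -expRN -expRM_natr ler_expR mulNr lerN2.
  by rewrite mulrAC mulrC ler_pM2l ?(ltW N_gt).
have /choice[B0 hB0] : forall j : nat, exists b : nat, forall B : nat, (b <= B)%N ->
     C * expR (k * x) <= \sum_(n < B | x + d * (2 * j%:R) < lam n <= x + d * (2 * j%:R + 1)) A n.
  move=> j.
  have xj : 0 <= d * (2 * j%:R) by rewrite !mulr_ge0 ?(ltW d0).
  have [|B0 hB0] := hX1 (x + d * (2 * j%:R)); first by lra.
  exists B0 => B /hB0; rewrite (_ : x + d * (2 * j%:R + 1) = x + d * (2 * j%:R) + d).
    by apply: le_trans; rewrite ler_pM2l// ler_expR ler_pM2l// lerDl.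
  by ring.
pose B := \max_(j < N) B0 j.
have m0 : 0 < C * expR (k * x) by rewrite mulr_gt0 ?expR_gt0.
have mB j : (j < N)%N -> C * expR (k * x) <=
   \sum_(n < B | x + d * (2 * j%:R) < lam n <= x + d * (2 * j%:R + 1)) A n.
  by move=> jN; apply: hB0; exact: (leq_bigmax (Ordinal jN)).
have [b [b1 b2 b3]] := window_interpolation H (ltn0Sn _) d0 m0 A0 mB.
exists B, b; split=> //.
- move=> n nB; apply: le_trans (b1 n nB) _; rewrite ler_wpM2r//.
  rewrite mulrA ler_pdivrMr//.
  apply: le_trans (_ : 8 ^+ N <= _).
    have -> : (8:R) = 4 * 2 by ring.
    by rewrite exprMn ler_wpM2l ?exprn_ge0 ?natr_le_pow2.
  apply: le_trans E8 _.
  apply: le_trans (_ : 8 / C * (C * (expR (k * x) * expR (- (tau * x)))) <= _).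
    rewrite [leRHS]mulrA divfK ?lt0r_neq0// ler_wpM2l// -expRD ler_expR.
    have : tau * x <= k / 2 * x by rewrite ler_wpM2r// ge_min lexx.
    lra.
  rewrite -mulrA [leRHS](_ : _ = (8 / C + 2) * (C * (expR (k * x) * expR (- (tau * x))))); last by ring.
  by rewrite mulrA ler_wpM2r ?lerDl// !mulr_ge0 ?expR_ge0 ?(ltW C0).
- move=> t tH; apply: le_trans (b3 t tH) _.
  apply: le_trans (_ : 2 * 2^-1 ^+ N <= _).
    apply: le_trans (_ : 2 ^+ N * (4 ^+ N * (2 * ((d * H * 2) ^+ N * expR 1 ^+ N))) <= _).
      have dH : 0 <= d * H * 2 by rewrite !mulr_ge0 ?(ltW d0) ?(ltW H0).
      apply: ler_pM; rewrite ?natr_le_pow2//.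
        by rewrite mulrA !mulr_ge0 ?exprn_ge0 ?invr_ge0 ?mulr_ge0 ?(ltW d0) ?(ltW H0).
      rewrite ler_wpM2l ?exprn_ge0// ler_wpM2l// (_ : d * H * (2 * N%:R) = d * H * 2 * N%:R) ?mulrA//.
      rewrite exprMn -[leLHS]mulrA.
      by rewrite ler_wpM2l ?pow_le_expR_fact// exprn_ge0.
    rewrite [leLHS](_ : _ = 2 * (2 ^+ N * 4 ^+ N * (d * H * 2) ^+ N * expR 1 ^+ N)).
      rewrite -!exprMn ler_wpM2l// (_ : 2 * 4 * (d * H * 2) * expR 1 = 2^-1)//.
      by rewrite /d; field; rewrite !lt0r_neq0.
    by rewrite mulrCA !mulrA [_ * 2]mulrC !mulrA; ring.
  apply: le_trans (_ : 2 * expR (- (h * ln 2 * x)) <= _); first by rewrite ler_wpM2l.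
  rewrite ler_pM ?expR_ge0 ?lerDr ?divr_ge0 ?(ltW C0)// ler_expR lerN2.
  by rewrite ler_wpM2r// ge_min lexx orbT.
Qed.

End ExponentialApproximation.

(** * Approximable functions *)

Section Approximable.
Context {R : realType} (lam A : nat -> R) (H : R).
Implicit Types (g : R -> R[i]) (b : nat -> R[i]).

(* Requiring the coefficients to be small multiples of [A] supported beyond an
   arbitrary index, rather than merely bounded by [A], makes this class a
   linear space closed under uniform limits. *)
Definition approximable g := forall e : R, 0 < e -> forall n0 : nat,
  exists (B : nat) b,
  [/\ forall n, cabs (b n) <= e * A n,
      forall n, (n < n0)%N || (B <= n)%N -> b n = 0 &
      forall t, 0 <= t <= H ->
        cabs (g t - \sum_(n < B) b n * expi (- (lam n * t))) <= e].

Lemma sum_ord_widen0 (V : nmodType) (F : nat -> V) (m n : nat) : (m <= n)%N ->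
  (forall i, (m <= i)%N -> F i = 0) -> \sum_(i < n) F i = \sum_(i < m) F i.
Proof.
move=> mn F0; rewrite (big_ord_widen n F mn) [RHS]big_mkcond; apply: eq_bigr => i _.
by case: ltnP => // /F0.
Qed.

Lemma approximable_lim g :
  (forall e : R, 0 < e -> exists g', approximable g' /\
    forall t, 0 <= t <= H -> cabs (g t - g' t) <= e) -> approximable g.
Proof.
move=> gl e e0 n0; have e2 : 0 < e / 2 by rewrite divr_gt0.
have [g' [g'a gg']] := gl _ e2; have [B [b [b1 b2 b3]]] := g'a _ e2 n0.
exists B, b; split=> // [n|t tH]; last first.
  by apply: le_trans (cabsD3 (g' t) _ _) _; have := gg' t tH; have := b3 t tH; lra.
rewrite (_ : e * A n = e / 2 * A n + e / 2 * A n); last by field.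
by rewrite (le_trans (b1 n))// lerDl (le_trans (cabs_ge0 _) (b1 n)).
Qed.

Lemma approximableZ c g : approximable g -> approximable (fun t => c * g t).
Proof.
move=> ga e e0 n0; pose k := cabs c + 1.
have k0 : 0 < k by rewrite ltr_wpDl ?cabs_ge0.
have [B [b [b1 b2 b3]]] := ga _ (divr_gt0 e0 k0) n0.
have ck x : 0 <= x -> cabs c * (e / k * x) <= e * x.
  move=> x0; rewrite mulrA ler_wpM2r// mulrA ler_pdivrMr// mulrC ler_wpM2l ?(ltW e0)//.
  by rewrite lerDl.
exists B, (fun n => c * b n); split=> [n|n /b2 ->|t tH]; last 2 first.
- by rewrite mulr0.
- under eq_bigr do rewrite -mulrA.
  rewrite -mulr_sumr -mulrBr cabsM -[leRHS]mulr1; apply: le_trans (ck _ ler01).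
  by rewrite ler_wpM2l ?cabs_ge0// mulr1 b3.
have A0 : 0 <= A n by rewrite -(pmulr_rge0 _ (divr_gt0 e0 k0)) (le_trans _ (b1 n)) ?cabs_ge0.
rewrite cabsM; apply: le_trans (ck _ A0).
by rewrite ler_wpM2l ?cabs_ge0.
Qed.

Lemma approximableD f g : approximable f -> approximable g ->
  approximable (fun t => f t + g t).
Proof.
move=> fa ga e e0 n0; have e2 : 0 < e / 2 by rewrite divr_gt0.
have [B [b [b1 b2 b3]]] := fa _ e2 n0; have [C [c [c1 c2 c3]]] := ga _ e2 n0.
exists (maxn B C), (fun n => b n + c n); split=> [n|n|t tH].
- rewrite (_ : e * A n = e / 2 * A n + e / 2 * A n); last by field.
  exact: le_trans (cabsD _ _) (lerD (b1 n) (c1 n)).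
- rewrite geq_max => /orP[nn0|/andP[Bn Cn]].
    by rewrite b2 ?c2 ?addr0 ?nn0.
  by rewrite b2 ?c2 ?addr0 ?Bn ?Cn ?orbT.
- under eq_bigr do rewrite mulrDl.
  rewrite big_split/= (sum_ord_widen0 (F := fun n => b n * expi (- (lam n * t))) (leq_maxl _ _)); last first.
    by move=> i Bi; rewrite b2 ?mul0r// Bi orbT.
  rewrite (sum_ord_widen0 (F := fun n => c n * expi (- (lam n * t))) (leq_maxr _ _)); last first.
    by move=> i Ci; rewrite c2 ?mul0r// Ci orbT.
  rewrite opprD addrACA; apply: le_trans (cabsD _ _) _.
  by have := b3 t tH; have := c3 t tH; lra.
Qed.

Hypothesis A_ge0 : forall n, 0 <= A n.

Lemma approximable0 : approximable (fun=> 0).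
Proof.
move=> e e0 n0; exists 0%N, (fun=> 0); split=> // [n|t _].
  by rewrite cabs0 mulr_ge0// ltW.
by rewrite big_ord0 subr0 cabs0 ltW.
Qed.

Lemma approximable_sum (I : Type) (r : seq I) (F : I -> R -> R[i]) :
  (forall i, approximable (F i)) -> approximable (fun t => \sum_(i <- r) F i t).
Proof.
move=> Fa; elim: r => [|i r IH].
  by under eq_fun do rewrite big_nil; exact: approximable0.
by under eq_fun do rewrite big_cons; exact: approximableD.
Qed.

Lemma approximable_eq f g : (forall t, 0 <= t <= H -> f t = g t) ->
  approximable f -> approximable g.
Proof.
move=> fg fa; apply: approximable_lim => e e0; exists f; split=> // t tH.
by rewrite fg// subrr cabs0 ltW.
Qed.

Lemma approximable_horner (f : R -> R[i]) (p : {poly R[i]}) :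
  (forall k, approximable (fun t => f t ^+ k)) -> approximable (fun t => p.[f t]).
Proof.
move=> fa; under eq_fun do rewrite horner_coef.
by apply: approximable_sum => k; exact: approximableZ.
Qed.

End Approximable.

(** * Approximation of the powers of one exponential *)

Section PeriodicApproximable.
Context {R : realType} (lam A : nat -> R) (H : R).
Variables (K tau X1 : R).
Hypotheses (A_ge0 : forall n, 0 <= A n) (H_gt0 : 0 < H).
Hypothesis lam_incr : forall m n : nat, (m < n)%N -> lam m < lam n.
Hypotheses (K_gt0 : 0 < K) (tau_gt0 : 0 < tau).
Hypothesis exponential_approx : forall x, X1 <= x ->
    exists B (b : nat -> R),
    [/\ forall n, (n < B)%N -> `|b n| <= K * expR (- (tau * x)) * A n,
        forall n, lam n <= x -> b n = 0 &
        forall t, 0 <= t <= H ->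
          cabs (\sum_(n < B) (b n)%:C%C * expi (- (lam n * t)) - expi (- (x * t))) <=
          K * expR (- (tau * x))].

Lemma cos_ge_1B_sqr (x : R) : 0 <= x -> 1 - x ^+ 2 <= cos x.
Proof.
have sin_le y : 0 <= y -> `|@sin R y| <= y ^+ 1 / 1`!%:R.
  apply: (@integrated_bound _ (@sin R) (@cos R)) => // [|z _]; first exact: sin0.
  by rewrite expr0 fact0 divr1 ler_norml cos_geN1 cos_le1.
move=> x0; have : `|(@cos R \- cst 1) x| <= x ^+ 2 / 2`!%:R.
  apply: (@integrated_bound _ (@cos R \- cst 1) (fun y => - sin y - 0)) => // [|z z0].
    by rewrite /= cos0 subrr.
  by rewrite subr0 normrN sin_le.
rewrite /= ler_norml => /andP[h _]; have x2 := sqr_ge0 x.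
by move: h; rewrite (_ : 2`!%:R = 2 :> R)//; lra.
Qed.

(** The two smallness conditions on [d] ensure exp(-tau d) < 1 - (d H)^2: the left side is at most 1
    / (1 + tau d), and (1 + tau d)(1 - (d H)^2) loses at most tau d / 4 twice. A vertical line then
    fits between the disc of radius [rho] and the arc. *)
Lemma expi_pow_approximable (d : R) (m : nat) :
  0 < d -> d * H ^+ 2 <= tau / 4 -> (d * H) ^+ 2 <= 1 / 4 ->
  approximable lam A H (fun t => expi (- (d * t)) ^+ m).
Proof.
move=> d0 d1 d2 e e0 n0.
pose rho := expR (- (tau * d)); pose a : R := 1 - (d * H) ^+ 2.
have td0 : 0 < tau * d by rewrite mulr_gt0.
have rho_a : rho < a.
  rewrite /rho expRN; apply: le_lt_trans (_ : (1 + tau * d)^-1 < _).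
    by rewrite lef_pV2 ?posrE ?expR_gt0 ?expR_ge1Dx//; lra.
  rewrite -[_^-1]mul1r ltr_pdivrMr; last by lra.
  have : tau * d * (d * H) ^+ 2 <= tau * d * (1 / 4) by rewrite ler_wpM2l ?(ltW td0).
  have : (d * H) ^+ 2 <= d * (tau / 4).
    by rewrite exprMn expr2 -mulrA ler_wpM2l ?(ltW d0).
  rewrite /a; lra.
pose T : set (R[i]) := [set expi (- (d * t)) | t in [set t | 0 <= t <= H]].
have T1 z : T z -> cabs z = 1 by move=> [t _ <-]; rewrite cabs_expi.
have TRe z : T z -> a <= complex.Re z.
  move=> [t /= /andP[t0 tH] <-] /=; rewrite cosN.
  apply: le_trans (cos_ge_1B_sqr (mulr_ge0 (ltW d0) t0)).
  by rewrite lerD2l lerN2 lerXn2r ?nnegrE ?mulr_ge0 ?(ltW d0) ?(ltW H_gt0)// ler_pM2l.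
have rho0 : 0 <= rho by exact: expR_ge0.
have a1 : a <= 1 by rewrite /a lerBlDr lerDl sqr_ge0.
pose s := (rho + a) / 2.
have [rs sa] : rho < s /\ s < a by rewrite /s; split; lra.
(* From k0 on, the frequency d k admits an exponential approximation, and one supported beyond
   [n0]. *)
have [k0 hk0] : exists k0 : nat, forall k, (k0 <= k)%N -> Num.max X1 (lam n0) <= d * k%:R.
  exists (Num.bound `|Num.max X1 (lam n0) / d|) => k kb.
  rewrite mulrC -ler_pdivrMr//; apply: le_trans (ler_norm _) _.
  by apply: le_trans (ltW (archi_boundP (normr_ge0 _))) _; rewrite ler_nat.
(* One share e1 pays for the distance of the polynomial from z^m on the arc, the share K e1 for
   replacing its powers. *)
pose e1 := e / (1 + K).
have e10 : 0 < e1 by rewrite divr_gt0 ?addr_gt0.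
have [J [Q [Jk Q1 Q2]]] := polynomial_peak rho0 (lt_le_trans rho_a a1)
  (fun z Tz => eq_ind_r (fun x => x <= 1) (lexx _) (T1 z Tz)) rs sa TRe k0 e10 (lt_le_trans sa a1) T1.
pose P := 'X^J * Q * 'X^m.
have P0 k : (k < k0)%N -> P`_k = 0.
  move=> kk0; rewrite /P coefMXn; case: ifP => // _; rewrite coefXnM.
  by rewrite (leq_ltn_trans (leq_subr _ _) (leq_trans kk0 Jk)).
have Pe : l1norm rho P <= e1.
  rewrite /P l1normMXn; apply: le_trans Q1; rewrite ler_piMl ?l1norm_ge0//.
  by rewrite exprn_ile1 ?(ltW (lt_le_trans rho_a a1)).
(* Nothing is claimed below k0, where the coefficients of P vanish. *)
have /choice[f hf] : forall k : nat, exists p : nat * (nat -> R), (k0 <= k)%N ->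
    [/\ forall n, (n < p.1)%N -> `|p.2 n| <= K * rho ^+ k * A n,
        forall n, (n < n0)%N -> p.2 n = 0 &
        forall t, 0 <= t <= H ->
          cabs (\sum_(n < p.1) (p.2 n)%:C%C * expi (- (lam n * t)) - expi (- (d * t)) ^+ k)
           <= K * rho ^+ k].
  move=> k; case: (leqP k0 k) => [/hk0|_]; last by exists (0%N, fun=> 0).
  rewrite ge_max => /andP[Xk lk].
  have [B [b [b1 b2 b3]]] := exponential_approx Xk.
  have Ek : expR (- (tau * (d * k%:R))) = rho ^+ k.
    by rewrite /rho -expRM_natr mulrA mulNr.
  exists (B, b) => _; split=> /= [n nB|n nn0|t tH].
  - by rewrite -Ek b1.
  - by apply: b2; apply: le_trans lk; apply/ltW/lam_incr.
  - have := b3 t tH; rewrite Ek expiX (_ : - (d * k%:R * t) = - (d * t) * k%:R)//.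
    by ring.
pose c k n : R[i] := if (n < (f k).1)%N then ((f k).2 n)%:C%C else 0.
pose B := \max_(k < size P) (f k).1.
have eK : e = (1 + K) * e1 by rewrite /e1 mulrC divfK// lt0r_neq0 ?addr_gt0.
exists B, (fun n => \sum_(k < size P) P`_k * c k n); split=> [n|n nB|t tH].
- apply: le_trans (cabs_sum _ _ _) _.
  apply: le_trans (_ : l1norm rho P * (K * A n) <= _); last first.
    rewrite mulrA ler_wpM2r// eK mulrC ler_pM ?l1norm_ge0 ?(ltW K_gt0)//.
    by rewrite lerDr.
  rewrite /l1norm mulr_suml; apply: ler_sum => k _; rewrite cabsM.
  have [/P0 ->|k0k] := ltnP k k0; first by rewrite cabs0 !mul0r.
  rewrite -mulrA ler_wpM2l ?cabs_ge0// mulrA [rho ^+ k * K]mulrC.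
  rewrite /c; case: ifP => [nk|_]; first by rewrite cabsR; have [->] := hf _ k0k.
  by rewrite cabs0 !mulr_ge0 ?(ltW K_gt0) ?exprn_ge0.
- rewrite big1// => k _; have [/P0 ->|k0k] := ltnP k k0; first by rewrite mul0r.
  have [_ h _] := hf _ k0k.
  rewrite /c; case: ifP => [nk|_]; last by rewrite mulr0.
  case/orP: nB => [/h ->|Bn]; first by rewrite mulr0.
  have : (n < B)%N by apply: leq_trans nk _; exact: (leq_bigmax k).
  by rewrite ltnNge Bn.
- set z := expi (- (d * t)).
  have -> : \sum_(n < B) (\sum_(k < size P) P`_k * c k n) * expi (- (lam n * t)) =
      \sum_(k < size P) P`_k * \sum_(n < (f k).1) ((f k).2 n)%:C%C * expi (- (lam n * t)).
    under eq_bigr do rewrite mulr_suml.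
    rewrite exchange_big/=; apply: eq_bigr => k _.
    under eq_bigr do rewrite -mulrA.
    rewrite -mulr_sumr; congr (_ * _).
    rewrite (sum_ord_widen0 (F := fun n => c k n * expi (- (lam n * t))) (leq_bigmax k)).
      by apply: eq_bigr => n _; rewrite /c ltn_ord.
    by move=> i ki; rewrite /c ltnNge ki mul0r.
  have Tz : T z by exists t.
  apply: le_trans (cabsD3 P.[z] _ _) _; rewrite eK mulrDl mul1r lerD//.
    rewrite /P hornerM hornerXn -{1}[z ^+ m]mul1r -mulrBl cabsM cabsX (T1 z Tz) expr1n.
    by rewrite mulr1 cabsB Q2.
  rewrite horner_coef -sumrB; apply: le_trans (cabs_sum _ _ _) _.
  apply: le_trans (_ : K * l1norm rho P <= _); last by rewrite ler_wpM2l ?(ltW K_gt0).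
  rewrite mulr_sumr; apply: ler_sum => k _; rewrite -mulrBr cabsM mulrCA.
  have [/P0 ->|k0k] := ltnP k k0; first by rewrite cabs0 !mul0r.
  by rewrite ler_wpM2l ?cabs_ge0// cabsB; have [_ _ ->] := hf _ k0k.
Qed.

End PeriodicApproximable.

(** * Weierstrass approximation *)

Section Bernstein.
Context {R : realType}.
Implicit Types (h : nat -> R) (x : R).

(* Expectation of [h] under the binomial law of parameters [n] and [x]. *)
Fixpoint bernstein (n : nat) h x : R :=
  if n is n'.+1 then
    (1 - x) * bernstein n' h x + x * bernstein n' (h \o succn) x
  else h 0%N.

Lemma bernstein_poly n h : exists p : {poly R}, forall x, p.[x] = bernstein n h x.
Proof.
elim: n h => [|n IH] h; first by exists (h 0%N)%:P => x; rewrite hornerC.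
have [p pE] := IH h; have [q qE] := IH (h \o succn).
by exists ((1 - 'X) * p + 'X * q) => x; rewrite !hornerE pE qE.
Qed.

Lemma bernstein_le n h h' x : 0 <= x <= 1 -> (forall k, (k <= n)%N -> h k <= h' k) ->
  bernstein n h x <= bernstein n h' x.
Proof.
move=> /andP[x0 x1]; elim: n h h' => [|n IH] h h' hh /=; first exact: hh.
apply: lerD; apply: ler_wpM2l => //; rewrite ?subr_ge0//; apply: IH => k kn.
  by apply: hh; exact: leqW.
exact: hh.
Qed.

Lemma bernstein_affine n h a b x :
  bernstein n (fun k => a * h k + b) x = a * bernstein n h x + b.
Proof.
elim: n h => [//|n IH] h /=.
by rewrite IH (_ : _ \o _ = fun k => a * (h \o succn) k + b)// IH; ring.
Qed.

(** The centre [a] is arbitrary because the recursion shifts it by 1. *)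
Lemma bernstein_variance n (a x : R) :
  bernstein n (fun k => (k%:R - a) ^+ 2) x = (n%:R * x - a) ^+ 2 + n%:R * x * (1 - x).
Proof.
elim: n a => [|n IH] a /=; first by ring.
rewrite IH (_ : _ \o _ = fun k => (k%:R - (a - 1)) ^+ 2).
  by rewrite IH -natr1; ring.
by apply/funext => k /=; rewrite -natr1; ring.
Qed.

Lemma bernstein_sqr n (x : R) : (0 < n)%N -> 0 <= x <= 1 ->
  bernstein n (fun k => (k%:R / n%:R - x) ^+ 2) x <= n%:R^-1.
Proof.
move=> n0 /andP[x0 x1]; have nR : 0 < n%:R :> R by rewrite ltr0n.
have -> : (fun k => (k%:R / n%:R - x) ^+ 2) =
    fun k : nat => n%:R ^- 2 * (k%:R - n%:R * x) ^+ 2 + 0.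
  by apply/funext => k; field; rewrite pnatr_eq0 -lt0n.
rewrite bernstein_affine bernstein_variance subrr expr0n/= add0r addr0.
rewrite (_ : _ * _ = n%:R^-1 * (x * (1 - x))); last by field; rewrite pnatr_eq0 -lt0n.
by rewrite ler_piMr ?invr_ge0// mulr_ile1 ?subr_ge0//; lra.
Qed.

(** Bernstein's argument: |f(k/n) - f(x)| is at most e / 2 when k/n is within d of x, and at most 2M
    (k/n - x)^2 / d^2 otherwise. Averaging the sum of both bounds leaves e / 2 plus 2M / (d^2 n). *)
Lemma weierstrass (H : R) (g : R -> R) : 0 < H -> continuous g ->
  forall e : R, 0 < e ->
  exists p : {poly R}, forall t, 0 <= t <= H -> `|g t - p.[t]| <= e.
Proof.
move=> H0 cg e e0; pose f x := g (H * x).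
have cf : continuous f.
  move=> x; apply: (@continuous_comp _ _ _ ( *%R H) g); last exact: cg.
  exact: mulrl_continuous.
have [M M0 fM] : exists2 M : R, 0 < M & forall x, 0 <= x <= 1 -> `|f x| <= M.
  have [|c _ cM] := @EVT_max R (fun x => `|f x|) 0 1 ler01.
    by apply: continuous_subspaceT => x; apply: cvg_norm; exact: cf.
  exists (`|f c| + 1) => [|x x01]; first by rewrite ltr_wpDl.
  by rewrite (le_trans (cM _ _)) ?lerDl// in_itv.
have [d d0 fd] : exists2 d : R, 0 < d & forall x y, 0 <= x <= 1 -> 0 <= y <= 1 ->
    `|x - y| < d -> `|f x - f y| <= e / 2.
  have /compact_near_coveringP cov := @segment_compact R 0 1.
  have : \forall d \near 0^'+, `[0, 1] `<=`
      (fun x : R => forall y, `|x - y| < d -> `|f x - f y| <= e / 2).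
    apply: cov => x _.
    have e4 : 0 < e / 4 by rewrite divr_gt0.
    have /cvgrPdist_le/(_ _ e4) /nbhs_ballP[r /= r0 rf] := cf x.
    have r2 : 0 < r / 2 by rewrite divr_gt0.
    exists (ball x (r / 2), [set d | d < r / 2]) => /=.
      by split; [exact: nbhsx_ballx|exact: nbhs_right_lt].
    move=> [x' d] [/= xx' dr] y yd.
    have fx' : `|f x - f x'| <= e / 4.
      by apply: rf; move: xx'; rewrite /ball/= => xx'; lra.
    have fy : `|f x - f y| <= e / 4.
      apply: rf; move: xx'; rewrite /ball/= => xx'.
      by have := ler_distD x' x y; lra.
    by have := ler_distD (f x) (f x') (f y); rewrite [`|f x' - f x|]distrC; lra.
  move=> H1; have [d [hd d0]] := filter_ex (filterI H1 (nbhs_right_gt 0)).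
  by exists d => // x y x01 _; apply: hd; rewrite /= in_itv.
pose n := (Num.bound (4 * M / (d ^+ 2 * e))).+1.
have nR : 0 < n%:R :> R by rewrite ltr0n.
have n_big : 4 * M / (d ^+ 2 * e) <= n%:R.
  have : 0 <= 4 * M / (d ^+ 2 * e).
    by rewrite divr_ge0 ?mulr_ge0 ?exprn_ge0 ?(ltW d0) ?(ltW e0) ?(ltW M0).
  by move=> /archi_boundP /ltW /le_trans -> //; rewrite ler_nat.
have [p pE] := bernstein_poly n (fun k => f (k%:R / n%:R)).
exists (p \Po (H^-1 *: 'X)) => t /andP[t0 tH].
pose x := t / H; have x01 : 0 <= x <= 1.
  by rewrite divr_ge0 ?(ltW H0)//= ler_pdivrMr ?mul1r.
have -> : g t = f x by rewrite /f /x mulrC divfK ?lt0r_neq0.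
rewrite horner_comp hornerZ hornerX mulrC -/x pE.
have kn k : (k <= n)%N -> 0 <= k%:R / n%:R :> R /\ k%:R / n%:R <= 1 :> R.
  by move=> kn; rewrite divr_ge0//; split=> //; rewrite ler_pdivrMr// mul1r ler_nat.
have close k : (k <= n)%N -> `|f (k%:R / n%:R) - f x| <= 2 * M / d ^+ 2 * (k%:R / n%:R - x) ^+ 2 + e / 2.
  move=> /kn[k1 k2]; have k01 : 0 <= (k%:R / n%:R : R) <= 1 by rewrite k1.
  have q0 : 0 <= 2 * M / d ^+ 2 by rewrite divr_ge0 ?mulr_ge0 ?exprn_ge0 ?(ltW d0) ?(ltW M0).
  have [small|large] := ltP `|k%:R / n%:R - x| d.
    by apply: le_trans (fd _ _ k01 x01 small) _; rewrite lerDr mulr_ge0 ?sqr_ge0.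
  apply: le_trans (ler_normB _ _) _.
  have : `|f (k%:R / n%:R)| <= M by exact: fM.
  have : `|f x| <= M by exact: fM.
  have : 2 * M <= 2 * M / d ^+ 2 * (k%:R / n%:R - x) ^+ 2.
    rewrite -mulrA ler_peMr ?mulr_ge0 ?(ltW M0)// mulrC ler_pdivlMr ?exprn_gt0// mul1r.
    by rewrite -[leRHS]real_normK ?num_real// lerXn2r ?nnegrE ?(ltW d0).
  lra.
have var := bernstein_sqr (ltn0Sn _ : (0 < n)%N) x01.
have main : 2 * M / d ^+ 2 * bernstein n (fun k => (k%:R / n%:R - x) ^+ 2) x <= e / 2.
  apply: le_trans (_ : 2 * M / d ^+ 2 * n%:R^-1 <= _).
    by rewrite ler_wpM2l// divr_ge0 ?mulr_ge0 ?exprn_ge0 ?(ltW d0) ?(ltW M0).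
  rewrite ler_pdivrMr//; move: n_big; rewrite ler_pdivrMr ?mulr_gt0 ?exprn_gt0// => nb.
  by rewrite ler_pdivrMr ?exprn_gt0//; lra.
have up : bernstein n (fun k => f (k%:R / n%:R)) x <= f x + e.
  apply: le_trans (_ : bernstein n (fun k => 2 * M / d ^+ 2 * (k%:R / n%:R - x) ^+ 2 + (e / 2 + f x)) x <= _).
    apply: bernstein_le => // k /close; rewrite ler_norml => /andP[_]; lra.
  by rewrite bernstein_affine; lra.
have lo : f x - e <= bernstein n (fun k => f (k%:R / n%:R)) x.
  apply: le_trans (_ : bernstein n (fun k => - (2 * M / d ^+ 2) * (k%:R / n%:R - x) ^+ 2 + (f x - e / 2)) x <= _).
    by rewrite bernstein_affine; lra.
  apply: bernstein_le => // k /close; rewrite ler_norml => /andP[]; lra.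
by rewrite ler_norml; apply/andP; split; lra.
Qed.

End Bernstein.

(** * From exponentials to polynomials and continuous functions *)

Section ContinuousApproximable.
Context {R : realType} (lam A : nat -> R) (H d0 : R).
Hypotheses (A_ge0 : forall n, 0 <= A n) (H_gt0 : 0 < H) (d0_gt0 : 0 < d0).
Hypothesis expi_approx : forall d m, 0 < d -> d <= d0 ->
  approximable lam A H (fun t => expi (- (d * t)) ^+ m).

Lemma expi_linear (x : R) : 0 <= x -> cabs (expi (- x) - (1 - 'i%C * x%:C%C)) <= x ^+ 2.
Proof.
move=> x0; have := expi_taylor 2 x0.
rewrite (_ : 2 * (x ^+ 2 / 2`!%:R) = x ^+ 2); last first.
  by rewrite (_ : 2`!%:R = 2 :> R)//; field.
congr (cabs (_ - _) <= _).
rewrite /expi_poly horner_poly 2!big_ord_recl big_ord0 lift0 !expr0 !expr1 addr0.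
by rewrite (_ : 0`! = 1)%N// (_ : 1`! = 1)%N// !divr1 mulr1 mulNr.
Qed.

(** The variable t is the uniform limit, as d tends to 0, of the difference quotient (1 - exp(-i d
    t)) / (i d), whose powers are polynomials in exp(-i d t). *)
Lemma id_pow_approximable k : approximable lam A H (fun t => t%:C%C ^+ k).
Proof.
(* M bounds t and, for d <= 1, the quotient w; the summand 1 makes M >= 1, so that every product of
   k - 1 factors is at most [M ^+ k]. *)
apply: approximable_lim => e e0; pose M := 1 + H + H ^+ 2.
have M1 : 1 <= M by rewrite /M -addrA lerDl addr_ge0 ?sqr_ge0 ?(ltW H_gt0).
have M0 : 0 <= M by exact: le_trans M1.
pose c := H ^+ 2 * (k%:R * M ^+ k) + 1.
have c0 : 0 < c by rewrite ltr_wpDl// mulr_ge0 ?sqr_ge0// mulr_ge0 ?exprn_ge0.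
pose d := Num.min (Num.min d0 1) (e / c).
have d_gt0 : 0 < d by rewrite !lt_min d0_gt0 ltr01 divr_gt0.
have [dd0 d1 de] : [/\ d <= d0, d <= 1 & d <= e / c].
  by rewrite !ge_min !lexx !orbT.
clearbody d.
pose u : R[i] := ('i%C * d%:C%C)^-1.
pose p : {poly R[i]} := (u *: (1 - 'X)) ^+ k.
exists (fun t => p.[expi (- (d * t))]); split.
  by apply: approximable_horner => // m; exact: expi_approx.
move=> t /andP[t0 tH]; set z := expi _; pose w := u * (1 - z).
have -> : p.[z] = w ^+ k by rewrite /p horner_exp !hornerE.
have iC : cabs ('i%C : R[i]) = 1 by rewrite /cabs /= expr0n/= add0r expr1n sqrtr1.
have i0 : ('i%C : R[i]) != 0.
  by apply/eqP => /(congr1 (@cabs R)); rewrite iC cabs0 => /eqP; rewrite oner_eq0.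
have dC0 : d%:C%C != 0 :> R[i].
  by apply/eqP => /(congr1 (@cabs R)); rewrite cabsR cabs0 gtr0_norm// => E; move: d_gt0; rewrite E ltxx.
have wt : cabs (w - t%:C%C) <= d * H ^+ 2.
  have -> : w - t%:C%C = - u * (z - (1 - 'i%C * (d * t)%:C%C)).
    by rewrite /w /u rmorphM/=; field; rewrite dC0.
  rewrite cabsM cabsN cabsV cabsM iC mul1r cabsR gtr0_norm// mulrC ler_pdivrMr//.
  apply: le_trans (expi_linear (mulr_ge0 (ltW d_gt0) t0)) _.
  rewrite (_ : d * H ^+ 2 * d = (d * H) ^+ 2); last by ring.
  by rewrite lerXn2r ?nnegrE ?mulr_ge0 ?(ltW d_gt0) ?(ltW H_gt0)// ler_pM2l.
have tM : cabs (t%:C%C : R[i]) <= M.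
  by rewrite cabsR ger0_norm// /M; have := sqr_ge0 H; lra.
have wM : cabs w <= M.
  rewrite -[w](subrK t%:C%C); apply: le_trans (cabsD _ _) _; rewrite cabsR ger0_norm//.
  have : d * H ^+ 2 <= H ^+ 2 by rewrite ler_piMl ?sqr_ge0.
  by rewrite /M; lra.
rewrite cabsB subrXX cabsM.
apply: le_trans (_ : d * H ^+ 2 * (k%:R * M ^+ k) <= _); last first.
  apply: le_trans (_ : d * c <= _).
    by rewrite -mulrA ler_wpM2l ?(ltW d_gt0)// lerDl.
  by rewrite -ler_pdivlMr.
apply: ler_pM => //; rewrite ?cabs_ge0//.
apply: le_trans (cabs_sum _ _ _) _.
rewrite mulr_natl -[X in _ *+ X]card_ord -sumr_const; apply: ler_sum => i _.
rewrite cabsM !cabsX; apply: le_trans (_ : M ^+ (k.-1 - i) * M ^+ i <= _).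
  by apply: ler_pM; rewrite ?exprn_ge0 ?cabs_ge0// lerXn2r ?nnegrE ?cabs_ge0.
rewrite -exprD ler_weXn2l// subnK; first exact: leq_pred.
by case: k i {p c c0 de} => [[]//|k] i; rewrite -ltnS.
Qed.

Lemma continuous_approximable (g h : R -> R) : continuous g -> continuous h ->
  approximable lam A H (fun t => g t +i* h t)%C.
Proof.
have real (f : R -> R) : continuous f -> approximable lam A H (fun t => (f t)%:C%C).
  move=> cf; apply: approximable_lim => e e0.
  have [p pe] := weierstrass H_gt0 cf e0.
  exists (fun t => (map_poly (real_complex R) p).[t%:C%C]); split.
    by apply: approximable_horner => // k; exact: id_pow_approximable.
  by move=> t tH; rewrite horner_map/= -rmorphB cabsR pe.
move=> cg ch; apply: (@approximable_eq _ _ _ _ (fun t => (g t)%:C%C + 'i%C * (h t)%:C%C)).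
  by move=> t _; rewrite [RHS]complexE.
by apply: approximableD; [exact: real|apply: approximableZ => //; exact: real].
Qed.

End ContinuousApproximable.

(** * Growth of the summatory function *)

Section DivergentIntegrals.
Context {R : realType}.
Local Notation mu := (@lebesgue_measure R).

(** Each dyadic block from 2^n X to 2^(n+1) X contributes at least a / 2. *)
Lemma integral_ge_inv_diverges (f : R -> R) (a X : R) : 0 < a -> 1 <= X ->
  measurable_fun `[(1 : R)%R, +oo[ f -> (forall x, 1 <= x -> 0 <= f x) ->
  (forall x, X <= x -> a / x <= f x) ->
  (\int[mu]_(x in `[1%R, +oo[) (f x)%:E = +oo)%E.
Proof.
move=> a0 X1 mf f0 fa.
have X0 : 0 < X by lra.
have mfE : measurable_fun `[(1 : R)%R, +oo[ (fun x => (f x)%:E) by apply/measurable_EFinP.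
have sub (x : R) b : 1 <= x -> [set` Interval (BLeft x) b] `<=` `[1, +oo[.
  move=> x1 y /=; rewrite !in_itv/= => /andP[xy _]; rewrite andbT; exact: le_trans xy.
have pow n : 1 <= 2 ^+ n * X.
  by rewrite -[leLHS]mulr1 ler_pM// exprn_ege1 ?ler1n//.
have block n : ((a / 2)%:E <= \int[mu]_(x in `[(2 ^+ n * X)%R, (2 ^+ n.+1 * X)%R[) (f x)%:E)%E.
  set b := 2 ^+ n * X; have b0 : 0 < b by apply: lt_le_trans (pow n).
  have -> : 2 ^+ n.+1 * X = 2 * b by rewrite exprS mulrA.
  apply: le_trans (_ : (\int[mu]_(x in `[b, (2 * b)%R[) (cst (a / (2 * b))%:E) x <= _)%E).
    rewrite integral_cst//= lebesgue_measure_itv/= lte_fin ifT; last by lra.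
    by rewrite -EFinB -EFinM lee_fin le_eqVlt; apply/orP; left; apply/eqP; field; rewrite lt0r_neq0.
  apply: ge0_le_integral => //.
  - by move=> x _ /=; rewrite lee_fin divr_ge0 ?(ltW a0)// mulr_ge0 ?(ltW b0).
  - by apply: measurable_funS mfE => //; apply: sub; exact: pow.
  - move=> x /=; rewrite in_itv/= => /andP[bx xb]; rewrite lee_fin.
    apply: le_trans (fa x _); last first.
      by apply: le_trans bx; rewrite ler_peMl ?(ltW X0)// exprn_ege1 ?ler1n//.
    by rewrite ler_wpM2l ?(ltW a0)// lef_pV2 ?posrE ?(ltW xb)//; lra.
have sum n : ((n%:R * (a / 2))%:E <= \int[mu]_(x in `[X, (2 ^+ n * X)%R[) (f x)%:E)%E.
  elim: n => [|n IH].
    rewrite mul0r; apply: integral_ge0 => x /= /(sub _ _ X1) /=.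
    by rewrite in_itv/= andbT lee_fin => /f0.
  have Xn : X <= 2 ^+ n * X by rewrite ler_peMl ?(ltW X0)// exprn_ege1 ?ler1n//.
  have nn : 2 ^+ n * X <= 2 ^+ n.+1 * X.
    by rewrite exprS -mulrA ler_peMl ?ler1n// mulr_ge0 ?exprn_ge0 ?(ltW X0).
  have U : `[X, 2 ^+ n.+1 * X[%classic = `[X, 2 ^+ n * X[%classic `|` `[2 ^+ n * X, 2 ^+ n.+1 * X[%classic.
    by rewrite -itv_bndbnd_setU// ?bnd_simp.
  rewrite U ge0_integral_setU//=.
  - by rewrite -natr1 mulrDl mul1r EFinD leeD.
  - apply: measurable_funS mfE => // x.
    by move=> [/(sub _ _ X1)|/(sub _ _ (pow n))].
  - by move=> x [/(sub _ _ X1)|/(sub _ _ (pow n))]/=;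
      rewrite in_itv/= andbT lee_fin => /f0.
  - apply/disj_set2P/seteqP; split=> // x [] /=; rewrite !in_itv/= => /andP[_ h] /andP[h' _].
    by move: (lt_le_trans h h'); rewrite ltxx.
apply/eqyP => M M0.
pose n := Num.bound (M / (a / 2)).
have Mn : M <= n%:R * (a / 2).
  by rewrite -ler_pdivrMr ?divr_gt0// ltW// archi_boundP// divr_ge0 ?(ltW M0)// divr_ge0 ?(ltW a0).
apply: le_trans (_ : ((n%:R * (a / 2))%:E <= _)%E); first by rewrite lee_fin.
apply: le_trans (sum n) _; apply: ge0_subset_integral => //; last exact: sub.
by move=> x /=; rewrite in_itv/= andbT lee_fin => /f0.
Qed.

(** Replacing x by max(1, x) gives a function monotone on the whole line without changing it on the
    domain. *)
Lemma measurable_inv_ge1 : measurable_fun `[(1 : R)%R, +oo[ (fun x : R => x^-1).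
Proof.
apply: (eq_measurable_fun (fun x : R => (Num.max 1 x)^-1)).
  by move=> x; rewrite inE/= in_itv/= andbT => x1; rewrite max_r.
apply: nonincreasing_measurable => // x y xy.
rewrite lef_pV2 ?posrE ?lt_max ?ltr01//.
by rewrite ge_max le_max lexx/= le_max xy orbT.
Qed.

(** Otherwise eps >= y everywhere and the integrand dominates y / x. The consequence used later is
    that every fixed Y with 0 < Y <= c2 becomes admissible in the growth hypothesis for large X. *)
Lemma decreasing_vanishes (eps : R -> R) :
  (forall x : R, 1 <= x -> 0 < eps x) ->
  (forall x y : R, 1 <= x -> x <= y -> eps y <= eps x) ->
  (\int[mu]_(x in `[1%R, +oo[) (eps x / x)%:E < +oo)%E ->
  forall y, 0 < y -> exists2 X, 1 <= X & forall x, X <= x -> eps x <= y.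
Proof.
move=> e0 edecr eint y y0; apply: contrapT => noX.
have big x : 1 <= x -> y <= eps x.
  move=> x1; rewrite leNgt; apply/negP => ey; apply: noX; exists x => // z xz.
  exact: le_trans (edecr _ _ x1 xz) (ltW ey).
suff : (\int[mu]_(x in `[1%R, +oo[) (eps x / x)%:E = +oo)%E.
  by move=> E; move: eint; rewrite E ltxx.
apply: (@integral_ge_inv_diverges (fun x => eps x / x) y 1) => //.
- apply: measurable_funM; last exact: measurable_inv_ge1.
  apply: (eq_measurable_fun (fun x : R => eps (Num.max 1 x))).
    by move=> x; rewrite inE/= in_itv/= andbT => x1; rewrite max_r.
  apply: nonincreasing_measurable => // u v uv; apply: edecr; first by rewrite le_max lexx.
  by rewrite ge_max le_max lexx/= le_max uv orbT.
- by move=> x x1; rewrite divr_ge0 ?(ltW (e0 x x1)) ?(le_trans _ x1).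
- by move=> x x1; rewrite ler_wpM2r ?big// invr_ge0 (le_trans _ x1).
Qed.

End DivergentIntegrals.

Section SummatoryGrowth.
Context {R : realType} (lam A : nat -> R) (eps : R -> R).
Hypotheses (lam0 : lam 0%N = 0)
  (lam_incr : forall m n : nat, (m < n)%N -> lam m < lam n)
  (A0 : A 0%N = 1) (A_gt0 : forall n : nat, (1 <= n)%N -> 0 < A n)
  (Lambda_fin : forall x : R, (eLambda lam A x < +oo)%E)
  (eps_gt0 : forall x : R, 1 <= x -> 0 < eps x)
  (eps_decr : forall x y : R, 1 <= x -> x <= y -> eps y <= eps x)
  (eps_int :
    (\int[@lebesgue_measure R]_(x in `[1%R, +oo[) (eps x / x)%:E < +oo)%E)
  (Lambda_growth : exists c1 c2 c3 X0 : R,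
    [/\ 0 < c1, 0 < c2, 0 < c3, 1 <= X0 &
      forall X Y : R, X0 <= X -> c1 * eps X <= Y -> Y <= c2 ->
        c3 * Y * Lambda lam A X <= Lambda lam A (X + Y) - Lambda lam A X]).
Local Notation L := (Lambda lam A).

Lemma coef_ge0 n : 0 <= A n.
Proof. by case: n => [|n]; rewrite ?A0// ltW// A_gt0. Qed.

Lemma eLambda_ge0 x : (0 <= eLambda lam A x)%E.
Proof. by apply: esum_ge0 => n _; rewrite lee_fin coef_ge0. Qed.

Lemma eLambdaE x : eLambda lam A x = (L x)%:E.
Proof. by rewrite fineK// ge0_fin_numE ?eLambda_ge0. Qed.

Lemma Lambda_ndecr x y : x <= y -> L x <= L y.
Proof.
move=> xy; rewrite -lee_fin -2!eLambdaE /eLambda [leLHS]esum_mkcond [leRHS]esum_mkcond.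
apply: le_esum => n _; case: ifPn => [|_]; last first.
  by case: ifP => // _; rewrite lee_fin coef_ge0.
by rewrite inE/= => nx; rewrite ifT// inE/= (le_trans nx).
Qed.

Lemma Lambda_ge1 x : 0 <= x -> 1 <= L x.
Proof.
move=> x0; rewrite -lee_fin -eLambdaE; apply: esum_ge; exists [set 0%N].
  by split; [exact: finite_set1|move=> _ ->/=; rewrite lam0].
by rewrite fsbig_set1 A0.
Qed.

(** With bounded frequencies Lambda would be eventually constant and at least 1, against its growth
    over a step c2. This is what turns each value of Lambda into a finite sum. *)
Lemma lam_unbounded x : exists n, x < lam n.
Proof.
apply: contrapT => nx.
have lamx n : lam n <= x by rewrite leNgt; apply/negP => xn; apply: nx; exists n.
have const y : x <= y -> L y = L x.
  move=> xy; rewrite /Lambda /eLambda; congr (fine (esum _ _)).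
  by apply/seteqP; split=> n _ //=; exact: le_trans xy.
have [c1 [c2 [c3 [X0 [c10 c20 c30 X01 gr]]]]] := Lambda_growth.
have [X1 X11 eX] := decreasing_vanishes eps_gt0 eps_decr eps_int (divr_gt0 c20 c10).
pose X := Num.max (Num.max X0 X1) x.
have [XX0 XX1 Xx] : [/\ X0 <= X, X1 <= X & x <= X] by rewrite !le_max !lexx !orbT.
have := gr X c2 XX0; rewrite -ler_pdivlMl// mulrC eX// => /(_ isT (lexx _)).
rewrite !const ?subrr//; last by rewrite (le_trans Xx)// lerDl ltW.
have := Lambda_ge1 (le_trans ler01 (le_trans X01 XX0)); rewrite (const X)// => L1.
by rewrite leNgt (mulr_gt0 (mulr_gt0 c30 c20) (lt_le_trans ltr01 L1)).
Qed.

Lemma lam_le m n : (m <= n)%N -> lam m <= lam n.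
Proof. by rewrite leq_eqVlt => /predU1P[->//|/lam_incr/ltW]. Qed.

Lemma Lambda_sum B x : x < lam B -> L x = \sum_(n < B | lam n <= x) A n.
Proof.
move=> xB; have ltB n : lam n <= x -> (n < B)%N.
  move=> nx; rewrite ltnNge; apply/negP => /lam_le Bn.
  by move: (lt_le_trans xB (le_trans Bn nx)); rewrite ltxx.
have fin : finite_set [set n | lam n <= x].
  by apply: (sub_finite_set _ (finite_II B)) => n /= /ltB.
rewrite /Lambda /eLambda (_ : [set n | lam n <= x] = [set` (fun n => lam n <= x)])//.
rewrite esum_fset; last by move=> n _; rewrite lee_fin coef_ge0.
  rewrite -(bigfs _ (r := index_iota 0 B)) ?iota_uniq//; last first.
    by move=> n /= /ltB nB; rewrite mem_index_iota nB.
  by rewrite big_mkord sumEFin.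
exact: fin.
Qed.

Lemma Lambda_diff B X Y : 0 <= Y -> X + Y < lam B ->
  L (X + Y) - L X = \sum_(n < B | X < lam n <= X + Y) A n.
Proof.
move=> Y0 XB; rewrite !(@Lambda_sum B)//; last by apply: le_lt_trans XB; rewrite lerDl.
rewrite (bigID (fun n : 'I_B => lam n <= X))/= addrC.
rewrite [X in _ + X - _](_ : _ = \sum_(n < B | lam n <= X) A n); last first.
  apply: eq_bigl => n; rewrite andb_idl// => nX; apply: le_trans nX _.
  by rewrite lerDl.
by rewrite addrK; apply: eq_bigl => n; rewrite -ltNge andbC.
Qed.

(** Every step of length c2 multiplies Lambda by at least 1 + c3 c2. The constant C absorbs the
    starting point and the rounding to a whole number of steps. *)
Lemma Lambda_exp_growth : exists k C X1 : R, [/\ 0 < k, 0 < C, 1 <= X1 &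
  forall X, X1 <= X -> C * expR (k * X) <= L X].
Proof.
have [c1 [c2 [c3 [X0 [c10 c20 c30 X01 gr]]]]] := Lambda_growth.
have [X1 X11 eX] := decreasing_vanishes eps_gt0 eps_decr eps_int (divr_gt0 c20 c10).
pose X2 := Num.max X0 X1.
have [X20 X21] : X0 <= X2 /\ X1 <= X2 by rewrite !le_max !lexx orbT.
have q1 : 1 < 1 + c3 * c2 by rewrite ltrDl mulr_gt0.
have q0 : 0 < 1 + c3 * c2 by lra.
have iter n X : X2 <= X -> (1 + c3 * c2) ^+ n <= L (X + n%:R * c2).
  move=> X2X; elim: n => [|n IH]; first by rewrite expr0 mul0r addr0 Lambda_ge1//; lra.
  have nc : 0 <= n%:R * c2 by rewrite mulr_ge0 ?(ltW c20).
  have := gr (X + n%:R * c2) c2; rewrite -ler_pdivlMl// [c1^-1 * _]mulrC => gr'.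
  have {}gr' : c3 * c2 * L (X + n%:R * c2) <= L (X + n%:R * c2 + c2) - L (X + n%:R * c2).
    by apply: gr' => //; [lra|apply: eX; lra].
  rewrite (_ : X + n.+1%:R * c2 = X + n%:R * c2 + c2); last by rewrite -natr1; ring.
  rewrite exprS; apply: le_trans (_ : (1 + c3 * c2) * L (X + n%:R * c2) <= _).
    by rewrite ler_pM2l.
  by rewrite mulrDl mul1r; lra.
pose k := ln (1 + c3 * c2) / c2.
have k0 : 0 < k by rewrite divr_gt0// ln_gt0.
exists k, (expR (- (k * (X2 + c2)))), X2; split=> //; first exact: expR_gt0.
  by rewrite (le_trans X01).
move=> X XX2; rewrite -expRD.
pose n := Num.truncn ((X - X2) / c2).
have d0 : 0 <= (X - X2) / c2 by rewrite divr_ge0 ?(ltW c20)// subr_ge0.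
have n1 : n%:R * c2 <= X - X2 by rewrite -ler_pdivlMr// truncn_le.
have n2 : X - X2 < (n%:R + 1) * c2 by rewrite -ltr_pdivrMr// natr1 truncnS_gt.
apply: le_trans (_ : (1 + c3 * c2) ^+ n <= _); last first.
  apply: le_trans (iter n X2 (lexx _)) (Lambda_ndecr _); lra.
rewrite -[1 + c3 * c2 in leRHS](@lnK R) ?posrE// -expRM_natr ler_expR.
rewrite (_ : ln _ * n%:R = k * (n%:R * c2)); last by rewrite /k; field; rewrite lt0r_neq0.
rewrite addrC -mulrBr ler_pM2l//; lra.
Qed.

Lemma window_mass : exists k : R, 0 < k /\ forall d, 0 < d ->
  exists C X1 : R, 0 < C /\ forall X, X1 <= X ->
    exists B0, forall B : nat, (B0 <= B)%N ->
      C * expR (k * X) <= \sum_(n < B | X < lam n <= X + d) A n.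
Proof.
have [k [C [X1 [k0 C0 X11 LX]]]] := Lambda_exp_growth; exists k; split=> // d d0.
have [c1 [c2 [c3 [X0 [c10 c20 c30 X01 gr]]]]] := Lambda_growth.
pose Y := Num.min d c2; have Y0 : 0 < Y by rewrite lt_min d0.
have [Yd Yc2] : Y <= d /\ Y <= c2 by rewrite !ge_min !lexx orbT.
clearbody Y.
have [X2 X21 eX] := decreasing_vanishes eps_gt0 eps_decr eps_int (divr_gt0 Y0 c10).
exists (c3 * Y * C), (Num.max (Num.max X0 X1) X2); split; first by rewrite !mulr_gt0.
move=> X; rewrite !ge_max -andbA => /and3P[XX0 XX1 XX2].
have [B0 hB0] := lam_unbounded (X + Y); exists B0 => B B0B.
have XB : X + Y < lam B by apply: lt_le_trans hB0 (lam_le B0B).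
apply: le_trans (_ : L (X + Y) - L X <= _).
  have := gr X Y XX0; rewrite -ler_pdivlMl// mulrC eX// => /(_ isT Yc2); apply: le_trans.
  by rewrite -mulrA ler_pM2l ?mulr_gt0 ?LX.
rewrite (Lambda_diff (ltW Y0) XB) [leLHS]big_mkcond [leRHS]big_mkcond.
apply: ler_sum => n _; case: ifP => [/andP[Xn nY]|_].
  by rewrite Xn (le_trans nY)// lerD2l.
by case: ifP => // _; exact: coef_ge0.
Qed.

Lemma log_integral_infinite :
  (\int[@lebesgue_measure R]_(x in `[1%R, +oo[) (ln (L x) / x ^+ 2)%:E = +oo)%E.
Proof.
have [k [C [X1 [k0 C0 X11 LX]]]] := Lambda_exp_growth.
(* Beyond this point k x / 2 outweighs |ln C|, so ln Lambda(x) >= k x / 2. *)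
pose X2 := Num.max X1 (2 * `|ln C| / k).
apply: (@integral_ge_inv_diverges _ _ (k / 2) X2); rewrite ?divr_gt0//.
- by rewrite le_max X11.
- apply: measurable_funM.
    apply: measurableT_comp; first exact: measurable_ln.
    by apply: nondecreasing_measurable => // x y; exact: Lambda_ndecr.
  rewrite (_ : (fun x : R => (x ^+ 2)^-1) = (fun x => (x^-1) ^+ 2)).
    by apply: measurable_funX; exact: measurable_inv_ge1.
  by apply/funext => x; rewrite exprVn.
- move=> x x1; rewrite divr_ge0 ?sqr_ge0// ln_ge0// Lambda_ge1//; lra.
- move=> x; rewrite ge_max => /andP[X1x]; rewrite ler_pdivrMr// => Cx.
  have x0 : 0 < x by lra.
  have E : ln (C * expR (k * x)) = ln C + k * x by rewrite lnM ?posrE ?expR_gt0// expRK.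
  have : ln (C * expR (k * x)) <= ln (L x).
    by rewrite ler_ln ?posrE ?mulr_gt0 ?expR_gt0 ?LX// (lt_le_trans ltr01)// Lambda_ge1 ?ltW.
  rewrite E => h.
  rewrite (_ : k / 2 / x = (k / 2 * x) / x ^+ 2); last by field; rewrite lt0r_neq0.
  rewrite ler_wpM2r ?invr_ge0 ?sqr_ge0//; apply: le_trans h.
  by have := ler_norm (- ln C); rewrite normrN; lra.
Qed.

End SummatoryGrowth.

(** * Square norms on the interval *)

Section SquareIntegral.
Context {R : realType} (H : R).
Local Notation mu := (@lebesgue_measure R).
Local Notation D := (`]0, H[%classic : set R).
Implicit Types f g : R -> R[i].

Definition cmeas f := measurable_fun D (fun t => complex.Re (f t)) /\
                      measurable_fun D (fun t => complex.Im (f t)).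

(** Estimates are made on the squared norm, for which the parallelogram law holds without square
    roots, also at infinite values. *)
Definition sqint f : \bar R := (\int[mu]_(t in D) (cabs (f t) ^+ 2)%:E)%E.

Lemma sqint_ge0 f : (0 <= sqint f)%E.
Proof. by apply: integral_ge0 => t _; rewrite lee_fin sqr_ge0. Qed.

Lemma L2normE f : L2norm H f = (sqint f `^ 2^-1)%E.
Proof.
rewrite /L2norm unlock /Lnorm /sqint [in RHS]integral_mkcond; congr (_ `^ _)%E.
apply: eq_integral => t _; rewrite !patchE; case: ifP => _.
  by rewrite /= ger0_norm ?cabs_ge0// powR_mulrn ?cabs_ge0.
by rewrite /= normr0 powR0.
Qed.

Lemma L2norm_lt f (e : R) : 0 < e -> (sqint f < (e ^+ 2)%:E)%E -> (L2norm H f < e%:E)%E.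
Proof.
move=> e0; rewrite L2normE poweR12_sqrt ?sqint_ge0//.
case: (sqint f) (sqint_ge0 f) => //= r; rewrite !lee_fin !lte_fin => r0 re.
by rewrite -[ltRHS]gtr0_norm// -sqrtr_sqr ltr_sqrt ?exprn_gt0.
Qed.

Lemma L2P f : L2 H f <-> cmeas f /\ (sqint f < +oo)%E.
Proof.
rewrite /L2 /= /cmeas L2normE.
split=> [[h1 h2 h3]|[[h1 h2] h3]]; split=> //.
  by apply: lty_poweRy h3; rewrite invr_eq0.
exact: poweR_lty.
Qed.

Lemma cmeasD f g : cmeas f -> cmeas g -> cmeas (fun t => f t + g t).
Proof.
move=> [f1 f2] [g1 g2]; split.
  rewrite (_ : (fun _ => _) = (fun t => complex.Re (f t) + complex.Re (g t))).
    exact: measurable_funD.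
  by apply/funext => t; case: (f t) (g t) => ? ? [].
rewrite (_ : (fun _ => _) = (fun t => complex.Im (f t) + complex.Im (g t))).
  exact: measurable_funD.
by apply/funext => t; case: (f t) (g t) => ? ? [].
Qed.

Lemma cmeasM f g : cmeas f -> cmeas g -> cmeas (fun t => f t * g t).
Proof.
move=> [f1 f2] [g1 g2]; split.
  rewrite (_ : (fun _ => _) = (fun t => complex.Re (f t) * complex.Re (g t) -
      complex.Im (f t) * complex.Im (g t))).
    by apply: measurable_funB; exact: measurable_funM.
  by apply/funext => t; case: (f t) (g t) => ? ? [].
rewrite (_ : (fun _ => _) = (fun t => complex.Re (f t) * complex.Im (g t) +
    complex.Im (f t) * complex.Re (g t))).
  by apply: measurable_funD; exact: measurable_funM.
by apply/funext => t; case: (f t) (g t) => ? ? [].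
Qed.

Lemma cmeas_cst (c : R[i]) : cmeas (fun=> c).
Proof. by split; exact: measurable_cst. Qed.

Lemma cmeasB f g : cmeas f -> cmeas g -> cmeas (fun t => f t - g t).
Proof.
move=> fm gm; rewrite (_ : (fun _ => _) = (fun t => f t + -1 * g t)).
  by apply: cmeasD => //; apply: cmeasM => //; exact: cmeas_cst.
by apply/funext => t; rewrite mulN1r.
Qed.

Lemma cmeas_sum (I : Type) (r : seq I) (F : I -> R -> R[i]) :
  (forall i, cmeas (F i)) -> cmeas (fun t => \sum_(i <- r) F i t).
Proof.
move=> Fm; elim: r => [|i r IH].
  by under eq_fun do rewrite big_nil; exact: cmeas_cst.
by under eq_fun do rewrite big_cons; exact: cmeasD.
Qed.

Lemma cmeas_expi (l : R) : cmeas (fun t => expi (- (l * t))).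
Proof.
have ml : measurable_fun D (fun t : R => - (l * t)).
  by apply: measurable_funN; apply: measurable_funM => //; exact: measurable_cst.
split; apply: measurableT_comp ml => //.
  by apply: continuous_measurable_fun; exact: continuous_cos.
by apply: continuous_measurable_fun; exact: continuous_sin.
Qed.

Lemma cmeas_sqr f : cmeas f -> measurable_fun D (fun t => (cabs (f t) ^+ 2)%:E).
Proof.
move=> [f1 f2]; rewrite (_ : (fun _ => _) =
    EFin \o (fun t => complex.Re (f t) ^+ 2 + complex.Im (f t) ^+ 2)).
  by apply/measurable_EFinP; apply: measurable_funD; exact: measurable_funX.
by apply/funext => t; rewrite /= cabs_sqr.
Qed.

Lemma sqint_sub f g : sqint (fun t => f t - g t) = sqint (fun t => g t - f t).
Proof. by apply: eq_integral => t _; rewrite cabsB. Qed.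

Lemma sqint_parallelogram f g : cmeas f -> cmeas g ->
  (sqint (fun t => f t + g t)%R + sqint (fun t => f t - g t)%R =
   2%:E * sqint f + 2%:E * sqint g)%E.
Proof.
move=> fm gm.
have nn (h : R -> R[i]) : forall t, D t -> (0 <= (cabs (h t) ^+ 2)%:E)%E.
  by move=> t _; rewrite lee_fin sqr_ge0.
have m2 (h : R -> R[i]) : cmeas h -> measurable_fun D (fun t => (2%:E * (cabs (h t) ^+ 2)%:E)%E).
  by move=> /cmeas_sqr; exact: measurable_funeM.
have mD := cmeas_sqr (cmeasD fm gm); have mB := cmeas_sqr (cmeasB fm gm).
have nn2 (h : R -> R[i]) : forall t, D t -> (0 <= 2%:E * (cabs (h t) ^+ 2)%:E)%E.
  by move=> t _; rewrite -EFinM lee_fin mulr_ge0 ?sqr_ge0.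
rewrite /sqint -ge0_integralD//; last 2 first.
- exact: (nn (fun t => f t + g t)).
- exact: (nn (fun t => f t - g t)).
rewrite -!ge0_integralZl//; try exact: cmeas_sqr.
all: try exact: nn.
rewrite -ge0_integralD//; try exact: m2; try exact: nn2.
by apply: eq_integral => t _; rewrite -!EFinM -!EFinD cabs_parallelogram.
Qed.

(** Dropping one nonnegative term of the parallelogram law gives a triangle inequality with factor
    2, good enough for all later error splittings. *)
Lemma sqintD_le f g : cmeas f -> cmeas g ->
  (sqint (fun t => f t + g t)%R <= 2%:E * sqint f + 2%:E * sqint g)%E.
Proof. by move=> fm gm; rewrite -sqint_parallelogram// leeDl ?sqint_ge0. Qed.

Lemma sqintB_le f g : cmeas f -> cmeas g ->
  (sqint (fun t => f t - g t)%R <= 2%:E * sqint f + 2%:E * sqint g)%E.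
Proof. by move=> fm gm; rewrite -sqint_parallelogram// leeDr ?sqint_ge0. Qed.

Lemma sqint_tri (h f g : R -> R[i]) : cmeas f -> cmeas g -> cmeas h ->
  (sqint (fun t => f t - g t)%R <=
    2%:E * sqint (fun t => f t - h t)%R + 2%:E * sqint (fun t => h t - g t)%R)%E.
Proof.
move=> fm gm hm; have := sqintD_le (cmeasB fm hm) (cmeasB hm gm).
by rewrite (_ : (fun t => f t - h t + (h t - g t)) = (fun t => f t - g t))//;
  apply/funext => t; rewrite subrKA.
Qed.

Hypothesis H_gt0 : 0 < H.

Lemma sqint_bound f (c : R) : cmeas f -> (forall t, 0 <= t <= H -> cabs (f t) <= c) ->
  (sqint f <= (c ^+ 2 * H)%:E)%E.
Proof.
move=> fm fc; have -> : (c ^+ 2 * H)%:E = (\int[mu]_(t in D) (cst (c ^+ 2)%:E) t)%E.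
  by rewrite integral_cst//= lebesgue_measure_itv/= lte_fin H_gt0 -EFinB subr0 -EFinM.
apply: ge0_le_integral => //.
- by move=> t _; rewrite lee_fin sqr_ge0.
- exact: cmeas_sqr.
- move=> t; rewrite /= in_itv/= => /andP[t0 tH]; rewrite lee_fin.
  have ct : cabs (f t) <= c by apply: fc; rewrite !ltW.
  by rewrite lerXn2r ?nnegrE ?cabs_ge0// (le_trans (cabs_ge0 _) ct).
Qed.

Lemma sqint_expi (d : R[i]) (l : R) :
  (sqint (fun t => d * expi (- (l * t)))%R <= (cabs d ^+ 2 * H)%:E)%E.
Proof.
apply: sqint_bound => [|t _]; last by rewrite cabsM cabs_expi mulr1.
by apply: cmeasM; [exact: cmeas_cst|exact: cmeas_expi].
Qed.

End SquareIntegral.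

(** * Density of continuous functions in the square norm *)

Section ContinuousDense.
Context {R : realType} (H : R).
Local Notation mu := (@lebesgue_measure R).
Local Notation D := (`]0, H[%classic : set R).

Lemma cvge0_lt (u : nat -> \bar R) : u @ \oo --> 0%E -> forall e : R, 0 < e ->
  exists N, forall n, (N <= n)%N -> (u n < e%:E)%E.
Proof.
move=> /fine_cvgP[ufin /cvgrPdist_lt uc] e e0.
have [N _ hN] := filterI ufin (uc _ e0); exists N => n /hN[/fineK <-].
by rewrite /= sub0r normrN lte_fin => /(le_lt_trans (ler_norm _)).
Qed.

Lemma cvge0_le (u : nat -> \bar R) : (forall n, (0 <= u n)%E) ->
  (forall e : R, 0 < e -> exists N, forall n, (N <= n)%N -> (u n <= e%:E)%E) ->
  u @ \oo --> 0%E.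
Proof.
move=> u0 ue; have ufin n (e : R) : (u n <= e%:E)%E -> u n \is a fin_num.
  by move=> h; rewrite ge0_fin_numE// (le_lt_trans h)// ltry.
apply/fine_cvgP; split.
  by have [N hN] := ue 1 ltr01; exists N => // n /= /hN/ufin.
apply/cvgrPdist_le => e /ue[N hN]; exists N => // n /= /hN h.
by rewrite sub0r normrN ger0_norm ?fine_ge0// -lee_fin fineK// (ufin _ _ h).
Qed.

Definition clip (M x : R) : R := Num.max (- M) (Num.min x M).

Lemma clip_bounds M x : 0 <= M -> - M <= clip M x <= M.
Proof.
move=> M0; rewrite /clip le_max lexx/= ge_max ge_min lexx orbT andbT; lra.
Qed.

Lemma clip_id M x : - M <= x -> x <= M -> clip M x = x.
Proof. by move=> h1 h2; rewrite /clip min_l// max_r. Qed.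

Lemma clip_dist M x y : 0 <= M -> `|clip M x - clip M y| <= `|x - y|.
Proof.
move=> M0; have h1 := ler_norm (x - y); have h2 := ler_norm (y - x).
rewrite distrC in h2; rewrite ler_norml /clip /Num.min.
by case: (ltP x M) => ?; case: (ltP y M) => ? /=; rewrite /Num.max;
  apply/andP; split; do ![case: ifPn; rewrite -?leNgt => ?]; lra.
Qed.

Lemma clip_sub M x : 0 <= M -> `|x - clip M x| <= `|x|.
Proof.
move=> M0; have h1 := ler_norm x; have h2 := ler_norm (- x); have h3 := normr_ge0 x.
rewrite normrN in h2; rewrite ler_norml /clip /Num.min.
by case: (ltP x M) => ? /=; rewrite /Num.max;
  apply/andP; split; case: ifPn; rewrite -?leNgt => ?; lra.
Qed.

Lemma clip_continuous M (g : R -> R) : 0 <= M -> continuous g ->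
  continuous (fun x => clip M (g x)).
Proof.
move=> M0 cg x; apply/cvgrPdist_le => e e0.
have /cvgrPdist_le/(_ _ e0) := cg x; apply: filterS => y; apply: le_trans.
exact: clip_dist.
Qed.

(** Approximation in mean becomes approximation in square mean: clipping the approximant to [-M, M]
    does not increase its distance from f, and that distance squared is at most 2M times itself. *)
Lemma bounded_continuous_approx (f : R -> R) (M e : R) :
  measurable_fun D f -> 0 < M -> (forall x, - M <= f x <= M) -> 0 < e ->
  exists2 g : R -> R, continuous g &
    (\int[mu]_(x in D) ((f x - g x) ^+ 2)%:E <= e%:E)%E.
Proof.
move=> mf M0 fM e0.
have muD : (mu D < +oo)%E by rewrite lebesgue_measure_itv/=; case: ifP => _; rewrite ?ltry// -EFinB ltry.
have intf : mu.-integrable D (EFin \o f).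
  apply: measurable_bounded_integrable => //.
  exists M; split; first exact: num_real.
  by move=> x Mx y _; apply: le_trans (ltW Mx); rewrite ler_norml fM.
have [g_ [cg ig gf]] := approximation_continuous_integrable (measurable_itv _) muD intf.
have [N /(_ N (leqnn N)) hN] := cvge0_lt gf (divr_gt0 e0 (mulr_gt0 (ltr0n _ 2) M0)).
exists (fun x => clip M (g_ N x)); first by apply: clip_continuous => //; exact: ltW.
have mg : measurable_fun D (fun x => clip M (g_ N x)).
  by apply: measurable_funTS; apply: continuous_measurable_fun; apply: clip_continuous => //; exact: ltW.
have mgN : measurable_fun D (g_ N).
  by apply: measurable_funTS; exact: continuous_measurable_fun.
apply: le_trans (_ : (\int[mu]_(x in D) ((2 * M)%:E * `|(f x - g_ N x)%:E|) <= _)%E); last first.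
  rewrite ge0_integralZl//; last 2 first.
  - by do 2 apply: measurableT_comp => //; exact: measurable_funB.
  - by rewrite lee_fin mulr_ge0// ltW.
  apply: le_trans (_ : ((2 * M)%:E * (e / (2 * M))%:E <= _)%E).
    by rewrite lee_pmul2l ?lte_fin ?mulr_gt0// ltW.
  by rewrite -EFinM lee_fin mulrC divfK// lt0r_neq0 ?mulr_gt0.
apply: ge0_le_integral => //.
- by move=> x _; rewrite lee_fin sqr_ge0.
- by apply/measurable_EFinP; apply: measurable_funX; exact: measurable_funB.
- by apply: measurable_funeM; do 2 apply: measurableT_comp => //; exact: measurable_funB.
move=> x _; rewrite -EFinM lee_fin -real_normK ?num_real// expr2 ler_pM//.
  have /andP[h1 h2] := fM x; have /andP[h3 h4] := clip_bounds (g_ N x) (ltW M0).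
  by rewrite ler_norml; apply/andP; split; lra.
by have /andP[h1 h2] := fM x; rewrite -{1}(clip_id h1 h2) clip_dist ?(ltW M0).
Qed.

(** Truncations of f converge to f in square mean by dominated convergence, with f^2 as majorant,
    which reduces to the bounded case. *)
Lemma continuous_dense (f : R -> R) (e : R) : measurable_fun D f ->
  (\int[mu]_(x in D) (f x ^+ 2)%:E < +oo)%E -> 0 < e ->
  exists2 g : R -> R, continuous g &
    (\int[mu]_(x in D) ((f x - g x) ^+ 2)%:E <= e%:E)%E.
Proof.
move=> mf f2 e0; pose fn (n : nat) x := clip n.+1%:R (f x).
have mfn n : measurable_fun D (fn n).
  by apply: measurable_maxr => //; apply: measurable_minr.
have : (\int[mu]_(x in D) ((f x - fn n x) ^+ 2)%:E)%E @[n --> \oo] --> (\int[mu]_(x in D) (cst 0%E) x)%E.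
  have := @dominated_cvg _ _ R mu D (measurable_itv _)
    (fun n x => ((f x - fn n x) ^+ 2)%:E) (cst 0%E) (fun x => (f x ^+ 2)%:E).
  apply => //.
  - move=> n; apply/measurable_EFinP; apply: measurable_funX.
    by apply: measurable_funB; [exact: mf|exact: mfn].
  - move=> x _; apply: cvge0_le => [n|d d0]; first by rewrite lee_fin sqr_ge0.
    exists (Num.bound `|f x|) => n nb.
    have : `|f x| <= n.+1%:R.
      apply: le_trans (ltW (archi_boundP (normr_ge0 _))) _.
      by rewrite ler_nat (leq_trans nb).
    by rewrite ler_norml => /andP[h1 h2]; rewrite /fn clip_id// subrr expr0n/= lee_fin ltW.
  - apply/integrableP; split; first by apply/measurable_EFinP; exact: measurable_funX.
    by under eq_integral do rewrite gee0_abs ?lee_fin ?sqr_ge0//.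
  - move=> n x _; rewrite gee0_abs ?lee_fin ?sqr_ge0//.
    rewrite -[leLHS]real_normK ?num_real// -[leRHS]real_normK ?num_real//.
    by rewrite lerXn2r ?nnegrE// clip_sub.
rewrite integral0 => /cvge0_lt/(_ (e / 4)) [|N /(_ N (leqnn N)) hN]; first by rewrite divr_gt0.
have [g cg gN] : exists2 g : R -> R, continuous g &
    (\int[mu]_(x in D) ((fn N x - g x) ^+ 2)%:E <= (e / 4)%:E)%E.
  apply: (@bounded_continuous_approx _ N.+1%:R) => // [x|]; last by rewrite divr_gt0.
  by rewrite clip_bounds.
have mg : measurable_fun D g.
  by apply: measurable_funTS; exact: continuous_measurable_fun.
exists g => //.
have mB (u v : R -> R) : measurable_fun D u -> measurable_fun D v ->
    measurable_fun D (fun x => ((u x - v x) ^+ 2)%:E).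
  by move=> mu' mv; apply/measurable_EFinP; apply: measurable_funX; apply: measurable_funB.
have m1 := mB _ _ mf (mfn N); have m2 := mB _ _ (mfn N) mg.
apply: le_trans (_ : (\int[mu]_(x in D) (2%:E * ((f x - fn N x) ^+ 2)%:E + 2%:E * ((fn N x - g x) ^+ 2)%:E) <= _)%E).
  apply: ge0_le_integral => //.
  - by move=> x _; rewrite lee_fin sqr_ge0.
  - exact: mB.
  - by apply: emeasurable_funD; exact: measurable_funeM.
  - move=> x _; rewrite -!EFinM -EFinD lee_fin.
    by have := sqr_ge0 ((f x - fn N x) - (fn N x - g x)); lra.
have nn (h : R -> R) : forall x, D x -> (0 <= 2%:E * (h x ^+ 2)%:E)%E.
  by move=> x _; rewrite -EFinM lee_fin mulr_ge0 ?sqr_ge0.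
rewrite ge0_integralD//; try exact: nn; try exact: measurable_funeM.
rewrite !ge0_integralZl//; try by [move=> x _; rewrite lee_fin sqr_ge0].
apply: le_trans (_ : 2%:E * (e / 4)%:E + 2%:E * (e / 4)%:E <= _)%E.
  by apply: leeD; rewrite lee_pmul2l// ltW.
by rewrite -!EFinM -EFinD lee_fin; lra.
Qed.

End ContinuousDense.

(** * Completeness of the square norm *)

Section Completeness.
Context {R : realType} (H : R).
Local Notation mu := (@lebesgue_measure R).
Local Notation D := (`]0, H[%classic : set R).
Local Notation sqint := (sqint H).
Local Notation cmeas := (cmeas H).

Lemma geometric_increments_cvg (x : nat -> R) (r : R) :
  (forall k, `|x k.+1 - x k| <= r * 2^-1 ^+ k) -> cvgn x.
Proof.
move=> xr; have : cvgn (series (telescope x)).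
  apply: normed_cvg; apply: (@series_le_cvg _ _ (geometric r 2^-1)).
  - by move=> n /=.
  - by move=> n /=; apply: le_trans (xr n).
  - exact: xr.
  - by apply: is_cvg_geometric_series; rewrite ger0_norm//; lra.
rewrite telescopeK => /cvg_ex[l xl]; apply/cvg_ex; exists (l + x 0%N).
have : (fun n => x n - x 0%N + x 0%N) @ \oo --> l + x 0%N.
  by apply: cvgD; [exact: xl|exact: cvg_cst].
by rewrite (_ : (fun n => _) = x)//; apply/funext => n; rewrite subrK.
Qed.

Lemma sum_geometric_le n : \sum_(k < n) 2^-1 ^+ k <= 2 :> R.
Proof.
suff -> : \sum_(k < n) 2^-1 ^+ k = 2 - 2 * 2^-1 ^+ n :> R.
  by rewrite gerBl mulr_ge0 ?exprn_ge0.
elim: n => [|n IH]; first by rewrite big_ord0 expr0; ring.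
by rewrite big_ord_recr/= IH exprS; field.
Qed.

(* Riesz-Fischer: sum_k 4^k |u_(k+1) - u_k|^2 has finite integral, hence is
   finite almost everywhere, and there the increments decay geometrically. *)
Lemma sqint_complete (u : nat -> R -> R[i]) (c : R) :
  (forall K, cmeas (u K)) ->
  (forall K M, (K <= M)%N -> (sqint (fun t => u M t - u K t)%R <= (c * 8^-1 ^+ K)%:E)%E) ->
  exists g, cmeas g /\
    forall K, (sqint (fun t => u K t - g t)%R <= (c * 8^-1 ^+ K)%:E)%E.
Proof.
move=> um uc.
have c0 : 0 <= c.
  have := le_trans (sqint_ge0 _ _) (uc 0%N 0%N (leqnn _)).
  by rewrite expr0 mulr1 lee_fin.
(* Against the hypothesis [8^-1 ^+ k] the weight [4 ^+ k] leaves the summable [2^-1 ^+ k], and its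
   square root gives increments of order [2^-1 ^+ k] wherever the sum is finite. *)
pose f k t : \bar R := (4 ^+ k * cabs (u k.+1 t - u k t) ^+ 2)%:E.
have f0 k t : (0 <= f k t)%E by rewrite lee_fin mulr_ge0 ?sqr_ge0 ?exprn_ge0.
have mf k : measurable_fun D (f k).
  rewrite (_ : f k = fun t => ((4 ^+ k)%:E * (cabs (u k.+1 t - u k t) ^+ 2)%:E)%E)//.
  by apply: measurable_funeM; exact: cmeas_sqr (cmeasB (um _) (um _)).
pose G t : \bar R := (\sum_(k <oo) f k t)%E.
have mG : measurable_fun D G by apply: (ge0_emeasurable_sum (P := xpredT)).
have intG : (\int[mu]_(t in D) G t < +oo)%E.
  rewrite /G integral_nneseries//.
  apply: le_lt_trans (ltry (2 * c)); apply: lime_le.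
    by apply: is_cvg_nneseries => n _ _; exact: integral_ge0.
  apply: nearW => n; rewrite big_mkord.
  apply: le_trans (_ : (\sum_(k < n) (c * 2^-1 ^+ k)%:E <= _)%E); last first.
    rewrite sumEFin lee_fin -mulr_sumr mulrC ler_wpM2r//.
    exact: sum_geometric_le.
  apply: lee_sum => k _; rewrite /f; under eq_integral do rewrite EFinM.
  have mw := cmeas_sqr (cmeasB (um k.+1) (um k)).
  rewrite ge0_integralZl//; try by [rewrite lee_fin exprn_ge0|move=> t _; rewrite lee_fin sqr_ge0].
  apply: le_trans (_ : (4 ^+ k)%:E * (c * 8^-1 ^+ k)%:E <= _)%E.
    by rewrite lee_wpmul2l ?lee_fin ?exprn_ge0//; exact: uc.
  by rewrite -EFinM lee_fin mulrCA -exprMn (_ : 4 * 8^-1 = 2^-1)//; field.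
have G0 t : (0 <= G t)%E by apply: nneseries_ge0.
have iG : mu.-integrable D G.
  apply/integrableP; split => //.
  by under eq_integral do rewrite gee0_abs//.
have Gfin : {ae mu, forall t, D t -> G t \is a fin_num}.
  by apply: integrable_ae iG; exact: measurable_itv.
(* Setting the functions to 0 on this null set makes them converge at every point of D, as needed
   for the measurability of the limit. *)
pose B := D `&` G @^-1` [set +oo%E].
have mB : measurable B by apply: mG => //; exact: emeasurable_set1.
pose chi t : R := \1_(~` B) t.
have mchi : cmeas (fun t => (chi t)%:C%C).
  by split; [apply: measurable_indic; exact: measurableC|exact: measurable_cst].
pose v K t := u K t * (chi t)%:C%C.
have vm K : cmeas (v K) by exact: cmeasM.
have chiE t : chi t = (t \notin B)%:R by rewrite /chi indicE in_setC.
have vcvg t : D t -> exists r, forall k, cabs (v k.+1 t - v k t) <= r * 2^-1 ^+ k.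
  move=> Dt; have [tB|tB] := boolP (t \in B).
    by exists 0 => k; rewrite /v chiE tB /= !mulr0 subrr cabs0 mul0r.
  have : G t \is a fin_num.
    rewrite ge0_fin_numE// ltey; apply: contra tB => /eqP Gt.
    by rewrite inE.
  move=> /fineK Gt; exists (Num.sqrt (fine (G t))) => k.
  rewrite /v chiE tB /= !mulr1 -ler_sqr ?nnegrE ?cabs_ge0 ?mulr_ge0 ?exprn_ge0 ?sqrtr_ge0//.
  rewrite exprMn sqr_sqrtr ?fine_ge0// -exprM mulnC exprM.
  rewrite -(@ler_pM2l R (4 ^+ k)) ?exprn_gt0// [leRHS]mulrCA -exprMn.
  rewrite (_ : 4 * 2^-1 ^+ 2 = 1 :> R); last by field.
  rewrite expr1n mulr1 -lee_fin Gt.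
  have := @nneseries_lim_ge _ (fun k => f k t) xpredT 0%N k.+1 (fun n _ _ => f0 n t).
  apply: le_trans; rewrite big_nat_recr//= leeDr//.
  by apply: sume_ge0.
pose g t : R[i] := (limn (fun k => complex.Re (v k t)) +i* limn (fun k => complex.Im (v k t)))%C.
have cRe t : D t -> (fun k => complex.Re (v k t)) @ \oo --> complex.Re (g t).
  move=> /vcvg[r hr]; apply: (@geometric_increments_cvg _ r) => k.
  apply: le_trans (hr k); rewrite (_ : _ - _ = complex.Re (v k.+1 t - v k t)) ?Re_le_cabs//.
  by case: (v k.+1 t) (v k t) => ? ? [].
have cIm t : D t -> (fun k => complex.Im (v k t)) @ \oo --> complex.Im (g t).
  move=> /vcvg[r hr]; apply: (@geometric_increments_cvg _ r) => k.
  apply: le_trans (hr k); rewrite (_ : _ - _ = complex.Im (v k.+1 t - v k t)) ?Im_le_cabs//.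
  by case: (v k.+1 t) (v k t) => ? ? [].
have gm : cmeas g.
  split.
    by apply: (measurable_fun_cvg (fun k => proj1 (vm k))) => t; exact: cRe.
  by apply: (measurable_fun_cvg (fun k => proj2 (vm k))) => t; exact: cIm.
exists g; split=> // K.
have -> : sqint (fun t => u K t - g t) = sqint (fun t => v K t - g t).
  apply: ae_eq_integral => //.
  - exact: cmeas_sqr (cmeasB _ _).
  - exact: cmeas_sqr (cmeasB _ _).
  case: Gfin => Z [mZ Z0 GZ]; exists Z; split=> // t /= neq; apply: GZ => hG.
  apply: neq => Dt; congr ((cabs (_ - _) ^+ 2)%:E).
  rewrite /v chiE (_ : t \notin B) ?mulr1//.
  by apply/negP; rewrite inE => -[_ /= Gt]; move: (hG Dt); rewrite Gt.
pose h M t : \bar R := (cabs (v (M + K)%N t - v K t) ^+ 2)%:E.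
have hcvg t : D t -> h ^~ t @ \oo --> (cabs (v K t - g t) ^+ 2)%:E.
  move=> Dt; apply: cvg_EFin; first exact: nearW.
  have split2 (z w : R[i]) : cabs (z - w) ^+ 2 =
      (complex.Re z - complex.Re w) * (complex.Re z - complex.Re w) +
      (complex.Im z - complex.Im w) * (complex.Im z - complex.Im w).
    by rewrite cabs_sqr; case: z w => ? ? [].
  rewrite (_ : fine \o _ = fun M => cabs (v (M + K)%N t - v K t) ^+ 2)//.
  rewrite cabsB split2; under eq_fun do rewrite split2.
  have r := cRe t Dt; rewrite -(cvg_shiftn K) in r.
  have i := cIm t Dt; rewrite -(cvg_shiftn K) in i.
  by apply: cvgD; apply: cvgM; apply: cvgB => //; exact: cvg_cst.
(* Fatou's lemma passes the bound on the distance between two members of the sequence to the limit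
   without changing the constant. *)
have -> : sqint (fun t => v K t - g t) = (\int[mu]_(t in D) limn_einf (h ^~ t))%E.
  apply: eq_integral => t; rewrite inE => Dt.
  by rewrite is_cvg_limn_einfE; [rewrite (cvg_lim _ (hcvg t Dt))|apply/cvg_ex; eexists; exact: hcvg].
have mh M : measurable_fun D (h M) by exact: cmeas_sqr (cmeasB _ _).
apply: le_trans (fatou mu (measurable_itv _) mh _) _.
  by move=> M t _; rewrite lee_fin sqr_ge0.
have hc M : (\int[mu]_(t in D) h M t <= (c * 8^-1 ^+ K)%:E)%E.
  apply: le_trans (uc K (M + K)%N (leq_addl _ _)).
  apply: ge0_le_integral => //.
  - by move=> t _; rewrite lee_fin sqr_ge0.
  - exact: mh.
  - exact: cmeas_sqr (cmeasB _ _).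
  move=> t _; rewrite lee_fin /v -mulrBl cabsM exprMn ler_piMr ?sqr_ge0//.
  by rewrite chiE cabsR; case: (_ \notin _); rewrite ?normr1 ?normr0 ?expr1n ?expr0n.
rewrite limn_einf_lim; apply: lime_le; first exact: is_cvg_einfs.
apply: nearW => n; apply: le_trans (hc n).
by apply: ereal_inf_lbound; exists n => /=.
Qed.

End Completeness.

(** * Greedy choice of signs *)

Section GreedySigns.
Context {R : realType} (H : R) (lam : nat -> R) (d : nat -> R[i]).
Hypothesis H_gt0 : 0 < H.
Local Notation sqint := (sqint H).
Local Notation cmeas := (cmeas H).
Let term n t := d n * expi (- (lam n * t)).

Lemma cmeas_term n : cmeas (term n).
Proof. by apply: cmeasM; [exact: cmeas_cst|exact: cmeas_expi]. Qed.

Lemma sqint0 : sqint (fun=> 0) = 0%E.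
Proof. by apply: integral0_eq => t _; rewrite cabs0 expr0n. Qed.

Section Run.
Variable reset : pred nat.

Definition greedy_sign (g : R -> R[i]) n : R[i] :=
  if (sqint (fun t => g t + term n t)%R <= sqint g + (cabs (d n) ^+ 2 * H)%:E)%E
  then 1 else -1.

(* The running sum is forgotten at each index of [reset]: every block between
   two resets is then small by itself, which yields convergence. *)
Fixpoint greedy_run n : R -> R[i] :=
  if n is n'.+1 then
    let g := if reset n' then fun=> 0 else greedy_run n' in
    fun t => g t + greedy_sign g n' * term n' t
  else fun=> 0.

Definition run_sign n : R[i] :=
  greedy_sign (if reset n then fun=> 0 else greedy_run n) n.

(* By the parallelogram law one of the two signs does not increase the square
   norm by more than the square norm of the new term. *)
Lemma greedy_sign_le g n (c : R) : cmeas g -> (sqint g <= c%:E)%E ->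
  (sqint (fun t => g t + greedy_sign g n * term n t)%R <=
    (c + cabs (d n) ^+ 2 * H)%:E)%E.
Proof.
move=> gm gc; have x_le := sqint_expi H_gt0 (d n) (lam n).
have gfin : sqint g \is a fin_num.
  by rewrite ge0_fin_numE ?sqint_ge0// (le_lt_trans gc) ?ltry.
have le_c : (sqint g + (cabs (d n) ^+ 2 * H)%:E <= (c + cabs (d n) ^+ 2 * H)%:E)%E.
  by rewrite EFinD leeD2r.
rewrite /greedy_sign; case: ifPn => [h|].
  rewrite (_ : (fun t => g t + 1 * term n t) = (fun t => g t + term n t)); last first.
    by apply/funext => t; rewrite mul1r.
  exact: le_trans h le_c.
rewrite -ltNge => h; apply: le_trans le_c.
rewrite (_ : (fun t => g t + -1 * term n t) = (fun t => g t - term n t)); last first.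
  by apply/funext => t; rewrite mulN1r.
rewrite leNgt; apply/negP => h'.
have := sqint_parallelogram gm (cmeas_term n); have := lteD h h'.
move: (sqint (fun t => _ + _)%R) (sqint (fun t => _ - _)%R) => P M.
move=> + E; rewrite {}E; apply/negP; rewrite -leNgt.
rewrite -(fineK gfin) -!EFinD -EFinM.
apply: le_trans (leeD (lexx _) (lee_wpmul2l _ x_le)) _; first by rewrite lee_fin.
by rewrite -EFinM -EFinD lee_fin; lra.
Qed.

Let base n : R -> R[i] := if reset n then fun=> 0 else greedy_run n.

(** The state to which the next term is added consists of the terms since the last reset. At N = 0
    the run is empty with or without a reset. *)
Lemma greedy_base N p : N = 0%N \/ reset N ->
  (forall n, (N < n <= N + p)%N -> ~~ reset n) ->
  base (N + p) = fun t => \sum_(N <= n < N + p) run_sign n * term n t.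
Proof.
move=> N0; elim: p => [|p IH] nr.
  rewrite addn0; apply/funext => t; rewrite big_geq// /base.
  by case: N0 => [->|->//]; case: ifP.
have {}IH : base (N + p) = fun t => \sum_(N <= n < N + p) run_sign n * term n t.
  by apply: IH => n /andP[h1 h2]; apply: nr; rewrite h1 addnS leqW.
rewrite {1}/base (negPf (nr _ _)); last by rewrite addnS ltnS leq_addr leqnn.
rewrite addnS /=; apply/funext => t; rewrite big_nat_recr/= ?leq_addr//; congr (_ + _).
by rewrite -/(base (N + p)) IH.
Qed.

(** Within a block the square norms add up as if the terms were orthogonal. *)
Lemma greedy_block N m : (N <= m)%N -> N = 0%N \/ reset N ->
  (forall n, (N < n < m)%N -> ~~ reset n) ->
  (sqint (fun t => \sum_(N <= n < m) run_sign n * term n t)%R <=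
     (\sum_(N <= n < m) cabs (d n) ^+ 2 * H)%:E)%E.
Proof.
move=> /subnKC <-; elim: (m - N)%N => {m}[|p IH] N0 nr.
  rewrite addn0 big_geq// (_ : (fun t => _) = fun=> 0) ?sqint0//.
  by apply/funext => t; rewrite big_geq.
have {}IH : (sqint (fun t => \sum_(N <= n < N + p) run_sign n * term n t)%R <=
     (\sum_(N <= n < N + p) cabs (d n) ^+ 2 * H)%:E)%E.
  by apply: IH => // n /andP[h1 h2]; apply: nr; rewrite h1 addnS ltnW.
have b : base (N + p) = fun t => \sum_(N <= n < N + p) run_sign n * term n t.
  by apply: greedy_base => // n /andP[h1 h2]; apply: nr; rewrite h1 addnS ltnS.
rewrite addnS big_nat_recr/= ?leq_addr//.
rewrite (_ : (fun t => _) = (fun t => base (N + p) t + greedy_sign (base (N + p)) (N + p) * term (N + p) t)).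
  apply: greedy_sign_le; rewrite b//.
  by apply: cmeas_sum => n; apply: cmeasM; [exact: cmeas_cst|exact: cmeas_term].
by apply/funext => t; rewrite big_nat_recr/= ?leq_addr//; congr (_ + _); rewrite b.
Qed.

End Run.

Lemma cmeas_partial_sum (s : nat -> R[i]) a b :
  cmeas (fun t => \sum_(a <= n < b) s n * term n t).
Proof. by apply: cmeas_sum => n; apply: cmeasM; [exact: cmeas_cst|exact: cmeas_term]. Qed.

(** Resets are placed at indices Ns j beyond which the tail of the squares is at most
    [S * 8^-1 ^+ j]. The partial sums at these indices then converge at the rate required by
    [sqint_complete], and the bound on incomplete blocks extends convergence to all partial sums. *)
Lemma greedy_series (S : R) : 0 < S ->
  (forall m, \sum_(0 <= n < m) cabs (d n) ^+ 2 * H <= S) ->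
  (forall e : R, 0 < e -> exists N, forall m, (N <= m)%N ->
    \sum_(N <= n < m) cabs (d n) ^+ 2 * H <= e) ->
  exists (s : nat -> R[i]) (g : R -> R[i]),
  [/\ forall n, s n = 1 \/ s n = -1, cmeas g, (sqint g <= (4 * S)%:E)%E,
      forall m, (sqint (fun t => \sum_(0 <= n < m) s n * term n t)%R <= (4 * S)%:E)%E &
      forall e : R, 0 < e -> exists N, forall m, (N <= m)%N ->
        (sqint (fun t => \sum_(0 <= n < m) s n * term n t - g t)%R <= e%:E)%E].
Proof.
move=> S0 Sd tail; have two0 : (0 <= 2%:E :> \bar R)%E by rewrite lee_fin.
have e8 j : 0 < S * 8^-1 ^+ j by rewrite mulr_gt0 ?exprn_gt0 ?invr_gt0.
have /choice[T hT] : forall j, exists N, forall a m, (N <= a)%N -> (a <= m)%N ->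
    \sum_(a <= n < m) cabs (d n) ^+ 2 * H <= S * 8^-1 ^+ j.
  move=> j; have [N hN] := tail _ (e8 j); exists N => a m Na am.
  apply: le_trans (hN m (leq_trans Na am)).
  rewrite (big_cat_nat Na am)/= lerDr; apply: sumr_ge0 => n _.
  by rewrite mulr_ge0 ?sqr_ge0 ?(ltW H_gt0).
pose fix Ns (j : nat) : nat := if j is j'.+1 then maxn (Ns j').+1 (T j) else 0%N.
have Ns_lt j : (Ns j < Ns j.+1)%N by rewrite /= leq_maxl.
have Ns_le j k : (j <= k)%N -> (Ns j <= Ns k)%N.
  elim: k => [|k IH]; first by rewrite leqn0 => /eqP ->.
  by rewrite leq_eqVlt => /predU1P[->//|/IH/leq_trans]; apply; exact: ltnW.
have NsS j m : (Ns j <= m)%N -> \sum_(Ns j <= n < m) cabs (d n) ^+ 2 * H <= S * 8^-1 ^+ j.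
  case: j => [_|j jm]; first by rewrite expr0 mulr1.
  by apply: hT => //; rewrite leq_maxr.
pose reset : pred nat := fun n => `[< exists j, n = Ns j >].
have resetN j : reset (Ns j) by apply/asboolP; exists j.
have noreset j n : (Ns j < n < Ns j.+1)%N -> ~~ reset n.
  move=> /andP[h1 h2]; apply/asboolP => -[k nk]; move: h1 h2; rewrite nk.
  have [kj|jk] := leqP k j; first by rewrite ltnNge Ns_le.
  by move=> _; rewrite ltnNge Ns_le.
pose s := run_sign reset.
(* The first block costs 2 S 8^-j and the remainder 2 * 4 S 8^-(j+1) = S 8^-j; the total 3 S 8^-j
   keeps the constant 4 through the induction. *)
have seg j m : (Ns j <= m)%N ->
    (sqint (fun t => \sum_(Ns j <= n < m) s n * term n t)%R <= (4 * S * 8^-1 ^+ j)%:E)%E.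
  have [p] := ubnP (m - Ns j)%N; elim: p j => // p IH j mp jm.
  have [mj|jm'] := leqP m (Ns j.+1).
    apply: le_trans (greedy_block (N := Ns j) _ _ _) _ => //; first by right.
      by move=> n /andP[h1 h2]; apply: (noreset j); rewrite h1 (leq_trans h2).
    by rewrite lee_fin (le_trans (NsS _ _ jm))// -mulrA ler_peMl ?(ltW (e8 _))//; lra.
  have jj := ltnW (Ns_lt j); have jm1 := ltnW jm'.
  rewrite (_ : (fun t => _) = (fun t => \sum_(Ns j <= n < Ns j.+1) s n * term n t +
      \sum_(Ns j.+1 <= n < m) s n * term n t)); last first.
    by apply/funext => t; rewrite -big_cat_nat.
  apply: le_trans (sqintD_le (cmeas_partial_sum _ _ _) (cmeas_partial_sum _ _ _)) _.
  have h1 : (sqint (fun t => \sum_(Ns j <= n < Ns j.+1) s n * term n t)%R <= (S * 8^-1 ^+ j)%:E)%E.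
    apply: le_trans (greedy_block (N := Ns j) _ _ _) _ => //; first by right.
      exact: noreset.
    by rewrite lee_fin NsS.
  have h2 : (sqint (fun t => \sum_(Ns j.+1 <= n < m) s n * term n t)%R <= (4 * S * 8^-1 ^+ j.+1)%:E)%E.
    by apply: IH => //; have := Ns_lt j; lia.
  apply: le_trans (leeD (lee_wpmul2l two0 h1) (lee_wpmul2l two0 h2)) _.
  by rewrite -!EFinM -EFinD lee_fin exprS; have := e8 j; lra.
pose u K : R -> R[i] := fun t => \sum_(0 <= n < Ns K) s n * term n t.
have uB K m : (Ns K <= m)%N -> (fun t => \sum_(0 <= n < m) s n * term n t - u K t) =
    (fun t => \sum_(Ns K <= n < m) s n * term n t).
  move=> Km; apply/funext => t; rewrite /u (big_cat_nat (leq0n _) Km)/=.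
  by rewrite addrAC subrr add0r.
have [||g [gm ug]] := @sqint_complete _ H u (4 * S).
- by move=> K; exact: cmeas_partial_sum.
- by move=> K M KM; rewrite uB ?Ns_le// seg ?Ns_le.
exists s, g; split=> //.
- by move=> n; rewrite /s /run_sign /greedy_sign; case: ifP; [left|right].
- have := ug 0%N; rewrite expr0 mulr1 sqint_sub.
  by rewrite (_ : (fun t => _) = g)//; apply/funext => t; rewrite /u big_geq// subr0.
- by move=> m; have := seg 0%N m (leq0n _); rewrite expr0 mulr1.
- move=> e e0; have [K hK] : exists K, 16 * S * 8^-1 ^+ K <= e.
    have /cvgrPdist_le/(_ (e / (16 * S))) : (8^-1 : R) ^+ n @[n --> \oo] --> (0 : R).
      by apply: cvg_expr; rewrite ger0_norm//; lra.
    case=> [|n _ /(_ n (leqnn n))]; first by rewrite divr_gt0 ?mulr_gt0.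
    rewrite sub0r normrN ger0_norm ?exprn_ge0// ler_pdivlMr ?mulr_gt0// => h.
    by exists n; rewrite mulrC.
  exists (Ns K) => m Km.
  apply: le_trans (sqint_tri (h := u K) _ _ _) _ => //; try exact: cmeas_partial_sum.
  rewrite uB//; apply: le_trans (leeD (lee_wpmul2l two0 (seg K m Km)) (lee_wpmul2l two0 (ug K))) _.
  by rewrite -!EFinM -EFinD lee_fin; lra.
Qed.

End GreedySigns.

(** * Density *)

Section Assembly.
Context {R : realType} (lam A : nat -> R) (H : R).
Local Notation mu := (@lebesgue_measure R).
Local Notation D := (`]0, H[%classic : set R).
Local Notation sqint := (sqint H).
Local Notation cmeas := (cmeas H).
Hypotheses (H_gt0 : 0 < H) (A_ge0 : forall n, 0 <= A n).
Hypothesis cont_approx : forall g h : R -> R, continuous g -> continuous h ->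
  approximable lam A H (fun t => g t +i* h t)%C.

Lemma cmeas_exponential_sum (b : nat -> R[i]) (m n : nat) :
  cmeas (fun t => \sum_(m <= k < n) b k * expi (- (lam k * t))).
Proof. by apply: cmeas_sum => k; apply: cmeasM; [exact: cmeas_cst|exact: cmeas_expi]. Qed.

Lemma sqint_approx (f : R -> R[i]) (e : R) (n0 : nat) :
  cmeas f -> (sqint f < +oo)%E -> 0 < e ->
  exists (B : nat) (b : nat -> R[i]),
  [/\ forall n, cabs (b n) <= A n,
      forall n, (n < n0)%N || (B <= n)%N -> b n = 0 &
      (sqint (fun t => f t - \sum_(0 <= n < B) b n * expi (- (lam n * t)))%R <= e%:E)%E].
Proof.
move=> fm ff e0; have [m1 m2] := fm.
have e8 : 0 < e / 8 by rewrite divr_gt0.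
have part (p : R -> R) : measurable_fun D p -> (forall t, p t ^+ 2 <= cabs (f t) ^+ 2) ->
    exists2 g : R -> R, continuous g & (\int[mu]_(x in D) ((p x - g x) ^+ 2)%:E <= (e / 8)%:E)%E.
  move=> mp pf; apply: continuous_dense => //; apply: le_lt_trans ff.
  apply: ge0_le_integral => //.
  - by move=> x _; rewrite lee_fin sqr_ge0.
  - by apply/measurable_EFinP; exact: measurable_funX.
  - exact: cmeas_sqr.
  - by move=> x _; rewrite lee_fin.
have [||g cg gf] := part (fun t => complex.Re (f t)) => //.
  by move=> t; rewrite cabs_sqr lerDl sqr_ge0.
have [||h ch hf] := part (fun t => complex.Im (f t)) => //.
  by move=> t; rewrite cabs_sqr lerDr sqr_ge0.
have mg : measurable_fun D g by apply: measurable_funTS; exact: continuous_measurable_fun.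
have mh : measurable_fun D h by apply: measurable_funTS; exact: continuous_measurable_fun.
pose k t : R[i] := (g t +i* h t)%C.
have km : cmeas k by [].
have fk : (sqint (fun t => f t - k t)%R <= (e / 4)%:E)%E.
  rewrite (_ : sqint _ = (\int[mu]_(x in D) (((complex.Re (f x) - g x) ^+ 2)%:E +
      ((complex.Im (f x) - h x) ^+ 2)%:E))%E); last first.
    by apply: eq_integral => t _; rewrite cabs_sqr /k; case: (f t).
  have mB (u v : R -> R) : measurable_fun D u -> measurable_fun D v ->
      measurable_fun D (fun x => ((u x - v x) ^+ 2)%:E).
    by move=> mu' mv; apply/measurable_EFinP; apply: measurable_funX; apply: measurable_funB.
  have n1 := mB _ _ m1 mg; have n2 := mB _ _ m2 mh.
  rewrite ge0_integralD//; try by [move=> x _; rewrite lee_fin sqr_ge0].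
  by apply: le_trans (leeD gf hf) _; rewrite -EFinD lee_fin; lra.
(* The bound 1 reduces [e' * A n] to [A n]; together with the other bound it gives e'^2 H <= e /
   4. *)
pose e' := Num.min 1 (e / (4 * H)).
have e'0 : 0 < e' by rewrite lt_min ltr01 divr_gt0// mulr_gt0.
have [e'1 e'H] : e' <= 1 /\ e' <= e / (4 * H) by rewrite !ge_min !lexx orbT.
have [B [b [b1 b2 b3]]] := cont_approx cg ch e'0 n0.
exists B, b; split=> // [n|].
  by apply: le_trans (b1 n) _; rewrite ler_piMl.
apply: le_trans (sqint_tri (h := k) fm (cmeas_exponential_sum _ _ _) km) _.
have kb : (sqint (fun t => k t - \sum_(0 <= n < B) b n * expi (- (lam n * t)))%R <= (e / 4)%:E)%E.
  apply: le_trans (sqint_bound H_gt0 (c := e') _ _) _.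
  - by apply: cmeasB => //; exact: cmeas_exponential_sum.
  - by move=> t tH; rewrite big_mkord b3.
  rewrite lee_fin; apply: le_trans (_ : e' * H <= _).
    by rewrite ler_pM2r// expr2 ler_piMl ?(ltW e'0).
  move: e'H; rewrite ler_pdivlMr ?mulr_gt0//; lra.
have two0 : (0 <= 2%:E :> \bar R)%E by rewrite lee_fin.
apply: le_trans (leeD (lee_wpmul2l two0 fk) (lee_wpmul2l two0 kb)) _.
by rewrite -!EFinM -EFinD lee_fin; lra.
Qed.

(** A point inside the circle is the midpoint of the chord perpendicular to its radius: d = i k b
    with |b|^2 (1 + k^2) = r^2, and any radius works for b = 0. *)
Lemma midpoint_of_circle (b : R[i]) (r : R) : 0 <= r -> cabs b <= r ->
  exists d, [/\ cabs d <= r, cabs (b + d) = r & cabs (b - d) = r].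
Proof.
move=> r0 br; have [b0|b0] := eqVneq (cabs b) 0.
  exists r%:C%C; rewrite (cabs0_eq0 b0) add0r sub0r cabsN cabsR ger0_norm//.
pose k := Num.sqrt (r ^+ 2 - cabs b ^+ 2) / cabs b.
have k2 : cabs b ^+ 2 * k ^+ 2 = r ^+ 2 - cabs b ^+ 2.
  rewrite /k exprMn exprVn mulrC divfK ?expf_neq0// sqr_sqrtr//.
  by rewrite subr_ge0 lerXn2r ?nnegrE ?cabs_ge0.
have sq (z : R[i]) : cabs z ^+ 2 = r ^+ 2 -> cabs z = r.
  by move=> /eqP; rewrite eqrXn2 ?cabs_ge0// => /eqP.
move: k2; rewrite cabs_sqr; clearbody k => k2.
exists ((- complex.Im b * k) +i* (complex.Re b * k))%C; split.
- rewrite -ler_sqr ?nnegrE ?cabs_ge0// cabs_sqr/=.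
  by have := sqr_ge0 (complex.Re b); have := sqr_ge0 (complex.Im b); nra.
- by apply: sq; rewrite cabs_sqr; case: b {br b0} k2 => x y /= k2; nra.
- by apply: sq; rewrite cabs_sqr; case: b {br b0} k2 => x y /= k2; nra.
Qed.

Lemma square_summable_tail : (\sum_(1 <= n <oo) ((A n) ^+ 2)%:E < +oo)%E ->
  forall e : R, 0 < e -> exists2 N, (1 <= N)%N & forall m,
    \sum_(N <= n < m) A n ^+ 2 * H <= e.
Proof.
move=> Afin e e0.
have F0 n : (0 <= (A n ^+ 2)%:E)%E by rewrite lee_fin sqr_ge0.
have tot : (\sum_(0 <= n <oo) ((A n) ^+ 2)%:E < +oo)%E.
  rewrite (@nneseries_split _ (fun n => (A n ^+ 2)%:E) 0 1)//.
  by rewrite lte_add_pinfty// big_nat1 ltry.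
have /cvge0_lt/(_ _ (divr_gt0 e0 H_gt0))[N hN] := nneseries_tail_cvg tot (fun n _ => F0 n).
exists N.+1 => // m; rewrite -mulr_suml -ler_pdivlMr// -lee_fin -sumEFin.
apply: le_trans (ltW (hN N.+1 (leqnSn _))).
exact: nneseries_lim_ge.
Qed.

(** One coefficient sequence serves both sharp statements: all its long partial sums and its limit
    are close to f. Below n0 the coefficients are simply [A n], and this fixed sum is subtracted
    from f before approximating. *)
Lemma dense_series (f : R -> R[i]) (e : R) :
  (\sum_(1 <= n <oo) ((A n) ^+ 2)%:E < +oo)%E ->
  cmeas f -> (sqint f < +oo)%E -> 0 < e ->
  exists (a : nat -> R[i]) (N : nat) (g : R -> R[i]),
  [/\ (1 <= N)%N /\ forall n, (1 <= n)%N -> cabs (a n) = A n,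
      (sqint (fun t => f t - dirichlet_poly lam a N t)%R <= e%:E)%E,
      cmeas g, (sqint (fun t => f t - g t)%R <= e%:E)%E &
      forall e' : R, 0 < e' -> exists M, forall m, (M <= m)%N ->
        (sqint (fun t => dirichlet_poly lam a m t - g t)%R <= e'%:E)%E].
Proof.
move=> Afin fm ff e0.
(* The greedy sums have square norm at most 4 * e / 16 = e / 4; with e / 4 for the approximation,
   the factor 2 on each adds up to e. *)
have t0 : 0 < e / 16 by rewrite divr_gt0.
have e4 : 0 < e / 4 by rewrite divr_gt0.
have [n0 n01 tail0] := square_summable_tail Afin t0.
pose E n t : R[i] := expi (- (lam n * t)).
pose base t : R[i] := \sum_(1 <= n < n0) (A n)%:C%C * E n t.
have basem : cmeas base by exact: cmeas_exponential_sum.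
have f'm : cmeas (fun t => f t - base t) by exact: cmeasB.
have two0 : (0 <= 2%:E :> \bar R)%E by rewrite lee_fin.
have basef : (sqint base < +oo)%E.
  apply: le_lt_trans (sqint_bound H_gt0 (c := \sum_(1 <= n < n0) A n) basem _) (ltry _).
  move=> t _; apply: le_trans (cabs_sum _ _ _) _; apply: ler_sum => n _.
  by rewrite cabsM cabs_expi mulr1 cabsR ger0_norm.
have f'f : (sqint (fun t => f t - base t)%R < +oo)%E.
  apply: le_lt_trans (sqintB_le fm basem) _.
  by rewrite lte_add_pinfty// lte_mul_pinfty.
have [B [b [b1 b2 b3]]] := sqint_approx n0 f'm f'f e4.
have /choice[d0 hd0] := fun n => midpoint_of_circle (A_ge0 n) (b1 n).
(* From B on, [b n] is 0 and [d n] has modulus [A n], so the signed terms alone continue the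
   series. *)
pose d n := if (n < n0)%N then 0 else d0 n.
have dA n : cabs (d n) ^+ 2 <= A n ^+ 2.
  rewrite lerXn2r ?nnegrE ?cabs_ge0// /d; case: ifP => _; first by rewrite cabs0.
  by have [] := hd0 n.
have dS m : \sum_(0 <= n < m) cabs (d n) ^+ 2 * H <= e / 16.
  have d0E k : (k <= n0)%N -> \sum_(0 <= n < k) cabs (d n) ^+ 2 * H = 0.
    move=> kn; rewrite big_nat big1// => n /andP[_ nk].
    by rewrite /d (leq_trans nk)// cabs0 expr0n mul0r.
  have [/d0E ->|/ltnW n0m] := leqP m n0; first exact: ltW.
  rewrite (big_cat_nat (leq0n n0) n0m)/= d0E// add0r; apply: le_trans (tail0 m).
  by apply: ler_sum => n _; rewrite ler_pM2r.
have dtail (x : R) : 0 < x -> exists N, forall m, (N <= m)%N ->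
    \sum_(N <= n < m) cabs (d n) ^+ 2 * H <= x.
  move=> x0; have [N _ hN] := square_summable_tail Afin x0; exists N => m _.
  by apply: le_trans (hN m); apply: ler_sum => n _; rewrite ler_pM2r.
have [s [g0 [s1 g0m g0S partS g0c]]] := greedy_series lam H_gt0 t0 dS dtail.
pose a n := if (n < n0)%N then (A n)%:C%C else b n + s n * d n.
pose P t := base t + \sum_(0 <= n < B) b n * E n t.
have Pm : cmeas P by apply: cmeasD => //; exact: cmeas_exponential_sum.
(* The index 0, absent from Dirichlet polynomials, contributes nothing on the right: n0 >= 1 makes
   [b] and [d] vanish there. *)
have aE m : (n0 <= m)%N -> (B <= m)%N -> dirichlet_poly lam a m =
    fun t => P t + \sum_(0 <= n < m.+1) s n * (d n * E n t).
  move=> n0m Bm; apply/funext => t; rewrite /dirichlet_poly /P /base.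
  have n0m1 : (n0 <= m.+1)%N by exact: leqW.
  have sum0 (F : nat -> R[i]) i j : (forall n, (i <= n < j)%N -> F n = 0) ->
      \sum_(i <= n < j) F n = 0.
    by move=> F0; rewrite big_nat big1.
  have drop (F : nat -> R[i]) : (forall n, (n < n0)%N -> F n = 0) ->
      \sum_(0 <= n < m.+1) F n = \sum_(n0 <= n < m.+1) F n.
    by move=> F0; rewrite (big_cat_nat (leq0n n0) n0m1)/= sum0 ?add0r.
  have -> : \sum_(0 <= n < B) b n * E n t = \sum_(n0 <= n < m.+1) b n * E n t.
    rewrite -drop; last by move=> n nn0; rewrite b2 ?nn0 ?mul0r.
    rewrite (big_cat_nat (leq0n B) (leqW Bm))/= [X in _ = _ + X]sum0 ?addr0// => n.
    by move=> /andP[Bn _]; rewrite b2 ?Bn ?orbT ?mul0r.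
  rewrite drop; last by move=> n nn0; rewrite /d nn0 mul0r mulr0.
  rewrite (big_cat_nat n01 n0m1)/= -addrA; congr (_ + _).
    by rewrite !big_nat; apply: eq_bigr => n /andP[_ h]; rewrite /a h.
  rewrite -big_split/= !big_nat; apply: eq_bigr => n /andP[h _].
  by rewrite /a ltnNge h/= mulrDl mulrA.
pose N := maxn n0 B.
have fP : (sqint (fun t => f t - P t)%R <= (e / 4)%:E)%E.
  rewrite (_ : (fun t => _) = (fun t => f t - base t - \sum_(0 <= n < B) b n * E n t))//.
  by apply/funext => t; rewrite /P opprD addrA.
have close (q : R -> R[i]) : cmeas q -> (sqint q <= (4 * (e / 16))%:E)%E ->
    (sqint (fun t => f t - (P t + q t))%R <= e%:E)%E.
  move=> qm qS; rewrite (_ : (fun t => _) = (fun t => f t - P t + -1 * q t)); last first.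
    by apply/funext => t; rewrite mulN1r opprD addrA.
  have qm' : cmeas (fun t => -1 * q t) by apply: cmeasM => //; exact: cmeas_cst.
  apply: le_trans (sqintD_le (cmeasB fm Pm) qm') _.
  rewrite (_ : sqint (fun t => -1 * q t) = sqint q); last first.
    by apply: eq_integral => t _; rewrite mulN1r cabsN.
  apply: le_trans (leeD (lee_wpmul2l two0 fP) (lee_wpmul2l two0 qS)) _.
  by rewrite -!EFinM -EFinD lee_fin; lra.
exists a, N, (fun t => P t + g0 t); split.
- split; first by rewrite leq_max n01.
  move=> n n1; rewrite /a; case: ifP => nn0; first by rewrite cabsR ger0_norm.
  rewrite /d nn0; have [_ h1 h2] := hd0 n.
  by case: (s1 n) => ->; rewrite ?mul1r ?mulN1r.
- rewrite aE ?leq_maxl ?leq_maxr//; apply: close => //.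
  exact: cmeas_partial_sum.
- exact: cmeasD.
- exact: close.
- move=> e' /g0c[M hM]; exists (maxn M N) => m.
  rewrite !geq_max => /and3P[Mm n0m Bm].
  rewrite aE// (_ : (fun t => _) = (fun t => \sum_(0 <= n < m.+1) s n * (d n * E n t) - g0 t)).
    by apply: hM; exact: leqW.
  by apply/funext => t; rewrite opprD addrACA subrr add0r.
Qed.

End Assembly.

Section DirichletPolynomials.
Context {R : realType} (lam : nat -> R) (H : R).

Lemma cmeas_dirichlet_poly a N : cmeas H (dirichlet_poly lam a N).
Proof. exact: cmeas_exponential_sum. Qed.

Lemma L2_dirichlet_poly a N : 0 < H -> L2 H (dirichlet_poly lam a N).
Proof.
move=> H0; apply/L2P; split; first exact: cmeas_dirichlet_poly.
apply: le_lt_trans (sqint_bound H0 (c := \sum_(1 <= n < N.+1) cabs (a n)) _ _) (ltry _).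
  exact: cmeas_dirichlet_poly.
move=> t _; apply: le_trans (cabs_sum _ _ _) _; apply: ler_sum => n _.
by rewrite cabsM cabs_expi mulr1.
Qed.

End DirichletPolynomials.

Theorem theorem3 (R : realType) (lam A : nat -> R) (eps : R -> R) (H : R)
  (lam0 : lam 0%N = 0)
  (lam_incr : forall m n : nat, (m < n)%N -> lam m < lam n)
  (A0 : A 0%N = 1)
  (A_gt0 : forall n : nat, (1 <= n)%N -> 0 < A n)
  (Lambda_fin : forall x : R, (eLambda lam A x < +oo)%E)
  (eps_gt0 : forall x : R, 1 <= x -> 0 < eps x)
  (eps_decr : forall x y : R, 1 <= x -> x <= y -> eps y <= eps x)
  (eps_int :
    (\int[@lebesgue_measure R]_(x in `[1%R, +oo[) (eps x / x)%:E < +oo)%E)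
  (Lambda_growth : exists c1 c2 c3 X0 : R,
    [/\ 0 < c1, 0 < c2, 0 < c3, 1 <= X0 &
      forall X Y : R, X0 <= X -> c1 * eps X <= Y -> Y <= c2 ->
        c3 * Y * Lambda lam A X <= Lambda lam A (X + Y) - Lambda lam A X])
  (H_gt0 : 0 < H) :
  let log_integral_diverges :=
    (\int[@lebesgue_measure R]_(x in `[1%R, +oo[)
       (ln (Lambda lam A x) / x ^+ 2)%:E = +oo)%E in
  let square_summable :=
    (\sum_(1 <= n <oo) ((A n) ^+ 2)%:E < +oo)%E in
  [/\ L2dense H (polys_le lam A) <-> log_integral_diverges,
      square_summable ->
        (L2dense H (polys_eq lam A) <-> log_integral_diverges) &
      square_summable ->
        (L2dense H (series_eq H lam A) <-> log_integral_diverges)].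
Proof.
move=> log_div sq_sum.
have A_ge0 := coef_ge0 A0 A_gt0.
have div : log_div by exact: log_integral_infinite Lambda_growth.
have [k [k0 mass]] := window_mass lam0 lam_incr A0 A_gt0 Lambda_fin eps_gt0 eps_decr eps_int Lambda_growth.
have [K [tau [X1 [K0 tau0 approx]]]] := exponential_approximation A_ge0 H_gt0 k0 mass.
(* The two bounds amount to the conditions d H^2 <= tau / 4 and (d H)^2 <= 1 / 4 of
   [expi_pow_approximable]. *)
pose d0 := Num.min (tau / (4 * H ^+ 2)) (1 / (2 * H)).
have d00 : 0 < d0 by rewrite lt_min !divr_gt0// mulr_gt0// exprn_gt0.
have cont : forall g h : R -> R, continuous g -> continuous h ->
    approximable lam A H (fun t => g t +i* h t)%C.
  move=> g h; apply: (continuous_approximable A_ge0 H_gt0 d00) => d m d_gt0.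
  rewrite le_min => /andP[d1 d2].
  apply: (expi_pow_approximable A_ge0 H_gt0 lam_incr K0 tau0 approx) => //.
    by move: d1; rewrite !ler_pdivlMr ?mulr_gt0 ?exprn_gt0//; lra.
  have dH0 : 0 <= d * H by rewrite mulr_ge0 ?ltW.
  have dH : d * H <= 1 / 2 by move: d2; rewrite ler_pdivlMr ?mulr_gt0//; lra.
  have : (d * H) * (d * H) <= 1 / 2 * (1 / 2) by rewrite ler_pM.
  by rewrite -expr2; lra.
have sq2 (e : R) : 0 < e -> 0 < e ^+ 2 / 2 /\ e ^+ 2 / 2 < e ^+ 2.
  by move=> e0; have := exprn_gt0 2 e0; split; lra.
have close (f g : R -> R[i]) (e : R) : 0 < e ->
    (sqint H (fun t => f t - g t)%R <= (e ^+ 2 / 2)%:E)%E -> (L2norm H (f \- g)%R < e%:E)%E.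
  move=> e0 fg; apply: L2norm_lt => //; apply: le_lt_trans fg _.
  by rewrite lte_fin; have [] := sq2 e e0.
split.
- split=> // _ f /L2P[fm ff] e e0; have [e2 _] := sq2 e e0.
  (* Support from index 1 on makes [b 0] vanish, since Dirichlet polynomials start at 1; [maxn 1 B]
     then provides a length of at least 1. *)
  have [B [b [b1 b2 b3]]] := sqint_approx H_gt0 A_ge0 cont 1 fm ff e2.
  exists (dirichlet_poly lam b (maxn 1 B)); split.
  + by exists (maxn 1 B), b; split=> //; rewrite leq_maxl.
  + exact: L2_dirichlet_poly.
  + apply: close => //; apply: le_trans b3; rewrite le_eqVlt; apply/orP; left.
    apply/eqP; congr (sqint H _); apply/funext => t; congr (_ - _).
    rewrite /dirichlet_poly; have B1 : (B <= (maxn 1 B).+1)%N by rewrite leqW ?leq_maxr.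
    transitivity (\sum_(0 <= n < (maxn 1 B).+1) b n * expi (- (lam n * t))).
      by rewrite [RHS]big_ltn// b2// mul0r add0r.
    rewrite (big_cat_nat (leq0n B) B1)/= [X in _ + X]big_nat [X in _ + X]big1 ?addr0// => n.
    by move=> /andP[Bn _]; rewrite b2 ?Bn ?orbT ?mul0r.
- move=> sq; split=> // _ f /L2P[fm ff] e e0; have [e2 _] := sq2 e e0.
  have [a [N [g [[N1 aA] fN _ _ _]]]] := dense_series H_gt0 A_ge0 cont sq fm ff e2.
  exists (dirichlet_poly lam a N); split; last exact: close.
    by exists N, a; split=> // n /andP[/aA].
  exact: L2_dirichlet_poly.
- move=> sq; split=> // _ f /L2P[fm ff] e e0; have [e2 _] := sq2 e e0.
  have [a [N [g [[_ aA] _ gm fg cg]]]] := dense_series H_gt0 A_ge0 cont sq fm ff e2.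
  have gL2 : L2 H g.
    apply/L2P; split=> //.
    rewrite (_ : g = fun t => f t - (f t - g t)); last by apply/funext => t; rewrite subKr.
    apply: le_lt_trans (sqintB_le fm (cmeasB fm gm)) _.
    by rewrite lte_add_pinfty// lte_mul_pinfty// (le_lt_trans fg)// ltry.
  exists g; split; [|by []|exact: close].
  split=> //; exists a; split=> //.
  apply: cvge0_le => [n|x x0]; first by rewrite L2normE poweR_ge0.
  have [x2 _] := sq2 x x0; have [M hM] := cg _ x2; exists M => m Mm.
  by apply/ltW/close => //; exact: hM.
Qed.
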